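(* Let $n \ge 2$ be a fixed integer. For a real number $V \ge 1$, let $N^\sharp_n(V)$ denote the number of subgroups $L \subseteq \mathbb{Z}^n$ of finite index such that $[\mathbb{Z}^n : L] \le V$ and $[\mathbb{Z}^n : L]$ is squarefree. Define $$\rho_n = \frac{6}{\pi^2} \prod_{p} \left(1 + \frac{p^{n-1}-1}{p^{n+1}-p^{n-1}}\right),$$ where the product runs over all prime numbers $p$. Then $$N^\sharp_n(V) = \frac{\rho_n + o(1)}{n} V^n$$ as $V \to \infty$.
   Context: Subgroups of finite index in $\mathbb{Z}^n$ are exactly the full-rank integer lattices contained in $\mathbb{Z}^n$, and the index $[\mathbb{Z}^n:L]$ equals the determinant of $L$. The $o(1)$ term may depend on $n$. *)

(* Defs.v *)
From HB Require Import structures.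
From mathcomp Require Import all_boot all_order all_algebra.
From mathcomp Require Import finmap.
From mathcomp Require Import all_classical all_reals all_analysis.

Set Implicit Arguments.
Unset Strict Implicit.
Unset Printing Implicit Defensive.

Import Order.TTheory GRing.Theory Num.Theory.
Import numFieldNormedType.Exports.

Local Open Scope classical_set_scope.
Local Open Scope ring_scope.

Definition is_subgroup (G : zmodType) (L : set G) : Prop := zmod_closed (mem L).

Definition cosets (G : zmodType) (L : set G) : set (set G) :=
  range (fun x : G => [set x + y | y in L]).

Definition finite_index (G : zmodType) (L : set G) : Prop :=
  finite_set (cosets L).

(* [G : L]; meaningful only under [finite_index L], since [fset_set] sends
   infinite sets to the empty set. *)
Definition subgroup_index (G : zmodType) (L : set G) : nat :=
  #|` fset_set (cosets L)|.

Definition squarefree (m : nat) : Prop :=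
  forall d : nat, (d ^ 2 %| m)%N -> d = 1%N.

Definition squarefree_sublattices (R : realType) (n : nat) (V : R) :
    set (set 'rV[int]_n) :=
  [set L | [/\ is_subgroup L, finite_index L,
               (subgroup_index L)%:R <= V & squarefree (subgroup_index L)]].

(* This set is finite: Z^n has finitely many subgroups of each finite index. *)
Definition Nsharp (R : realType) (n : nat) (V : R) : nat :=
  #|` fset_set (@squarefree_sublattices R n V)|.

Definition rho_factor (R : realType) (n p : nat) : R :=
  1 + (p%:R ^+ n.-1 - 1) / (p%:R ^+ n.+1 - p%:R ^+ n.-1).

(* For n >= 1 every factor is 1 + O(p^-2) and at least 1, so the partial
   products converge and the value does not depend on the order of the primes. *)
Definition rho (R : realType) (n : nat) : R :=
  6 / pi ^+ 2 * limn (fun k : nat => \prod_(0 <= p < k | prime p) rho_factor R n p).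

(* Main.v *)
(** A subgroup [L] of [G * Z] of index [m] is determined by the positive
    generator [d] of its projection to [Z], the subgroup [K] of [G] of elements
    [x] with [(x, 0)] in [L], of index [e = m / d], and a class [v] modulo [K]
    with [(v, d)] in [L].  Hence the number [a_n(m)] of subgroups of index [m] of
    [Z^n] satisfies [a_{n+1}(m) = \sum_(e | m) e * a_n(e)], and for squarefree [m]
    it is the product over [p | m] of [1 + p + ... + p^(n-1)].

    So [a_n(m) / m^(n-1)], extended by 0 outside the squarefree numbers, is a
    product of local weights.  Let [S_y(N)] be the sum of [m^(n-1)] times the
    weights at the primes [p < y], over [m <= N].  Each prime [p] contributes
    [S_{p+1}(N) = S_p(N) + (s - 1) p^(n-1) S_p(N/p) - s p^(2n-2) S_p(N/p^2)], with
    [s = 1 + p^-1 + ... + p^-(n-1)].  This yields [S_y(N) ~ N^n/n * P_y] with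
    [P_y] the product of [1 - p^-(n+1)] over [p < y], and also
    [|S_y(N) - S_z(N)| = O(N^n / y)] for [y <= z], uniformly in [N], so that the
    limits in [y] and [N] can be exchanged.

    Finally [(1 - p^-2)] times the [p]-th factor of [rho] is [1 - p^-(n+1)], and
    the product of the [1 - p^-2] is [6 / pi^2]: a sieve reduces this to
    [\sum_j (2j+1)^-2 = pi^2/8], which follows from the identity
    [1/sin^2 t + 1/cos^2 t = 4/sin^2 (2t)] iterated from [t = pi/4], as
    [1/sin^2 t - 1 <= 1/t^2 <= 1/sin^2 t]. *)

Require Import Defs.
From mathcomp Require Import all_boot all_order all_algebra.
From mathcomp Require Import finmap.
From mathcomp Require Import all_classical all_reals all_analysis.
From mathcomp Require Import ring lra zify.
Import Order.TTheory GRing.Theory Num.Theory.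
Import numFieldNormedType.Exports.
Local Open Scope classical_set_scope.
Local Open Scope ring_scope.

Set Implicit Arguments.
Unset Strict Implicit.
Unset Printing Implicit Defensive.

(** * Counting subgroups of finite index *)

(** The index is encoded by a surjective labelling whose fibres are the cosets, so that labels can
    be paired and restricted without handling sets of cosets; [has_indexP] links it to
    [subgroup_index]. *)
Definition has_index (G : zmodType) (L : set G) (m : nat) : Prop :=
  exists r : G -> 'I_m, (forall i, exists x, r x = i) /\
    (forall x y, r x = r y <-> L (x - y)).

Section Subgroups.
Variables (G : zmodType) (L : set G).
Hypothesis sL : is_subgroup L.

Lemma subgroup0 : L 0.
Proof. by case: sL => /set_mem. Qed.

Lemma subgroupB x y : L x -> L y -> L (x - y).
Proof.
by case: sL => _ h Lx Ly; apply/set_mem/h; exact: mem_set.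
Qed.

Lemma subgroupN x : L x -> L (- x).
Proof. by move=> Lx; rewrite -sub0r; exact: subgroupB subgroup0 Lx. Qed.

Lemma subgroupD x y : L x -> L y -> L (x + y).
Proof. by move=> Lx Ly; rewrite -[y]opprK; apply: subgroupB => //; exact: subgroupN. Qed.

Lemma subgroupMz x k : L x -> L (x *~ k).
Proof.
move=> Lx; have h n : L (x *+ n).
  by elim: n => [|n IH]; [rewrite mulr0n; exact: subgroup0 | rewrite mulrS; exact: subgroupD].
by case: k => n; [exact: h | rewrite NegzE mulrNz; apply: subgroupN; exact: h].
Qed.

Lemma coset_eq x y :
  [set x + z | z in L] = [set y + z | z in L] <-> L (x - y).
Proof.
split=> [e|h].
  have : [set y + z | z in L] x by rewrite -e; exists 0; [exact: subgroup0 | rewrite addr0].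
  by case=> z Lz <-; rewrite addrC addKr.
apply/seteqP; split=> _ [z Lz <-].
  by exists (x - y + z); [exact: subgroupD | rewrite addrA (addrC y) subrK].
exists (z - (x - y)); first exact: subgroupB.
by rewrite opprB addrCA [x + _]addrC subrK addrC.
Qed.

End Subgroups.

Lemma is_subgroupI (G : zmodType) (L : set G) :
  L 0 -> (forall x y, L x -> L y -> L (x - y)) -> is_subgroup L.
Proof.
by move=> h0 hB; split=> [|x y /set_mem Lx /set_mem Ly]; apply: mem_set => //; exact: hB.
Qed.

Lemma card_fset_set_range (T : finType) (U : choiceType) (f : T -> U) (A : set U) :
  injective f -> A = range f -> finite_set A /\ #|` fset_set A| = #|T|.
Proof.
move=> fI ->.
have -> : range f = [set` [fset y in [seq f x | x <- enum T]]%fset].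
  apply/seteqP; split=> y /=; rewrite !inE.
    by case=> x _ <-; apply: map_f; rewrite mem_enum.
  by case/mapP => x _ ->; exists x.
split; first exact: finite_fset.
have fU : uniq [seq f x | x <- enum T] by rewrite map_inj_uniq // enum_uniq.
by rewrite set_fsetK card_fseq undup_id // size_map cardE.
Qed.

Lemma has_indexP (G : zmodType) (L : set G) (m : nat) : is_subgroup L ->
  has_index L m <-> finite_index L /\ subgroup_index L = m.
Proof.
move=> sL; pose co x := [set x + z | z in L]; split.
  case=> r [rS rP].
  have [s sP] : exists s : 'I_m -> G, forall i, r (s i) = i.
    by exists (fun i => projT1 (cid (rS i))) => i; case: cid.
  have := @card_fset_set_range _ _ (co \o s) (cosets L).
  rewrite card_ord; apply.
    by move=> i j /(coset_eq sL) /rP; rewrite !sP.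
  apply/seteqP; split=> C [x _ <-].
    by exists (r x) => //; apply/(coset_eq sL)/rP.
  by exists (s x).
move=> [fL <-]; pose F := fset_set (cosets L).
have cF x : co x \in F by rewrite in_fset_set // inE; exists x.
have h x : (index (co x) F < #|` F|)%N by rewrite index_mem cF.
exists (fun x => Ordinal (h x)); split=> [i|x y].
  have : nth set0 F i \in F by apply: mem_nth.
  rewrite in_fset_set // inE => -[x _ e]; exists x; apply: val_inj => /=.
  by rewrite /co e index_uniq // fset_uniq.
split=> [[e]|/(coset_eq sL) e].
  by apply/(coset_eq sL); rewrite -/(co x) -(nth_index set0 (cF x)) e nth_index.
by apply: val_inj; rewrite /= /co e.
Qed.

Lemma has_index_unique (G : zmodType) (L : set G) m m' : is_subgroup L ->
  has_index L m -> has_index L m' -> m = m'.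
Proof. by move=> sL /(has_indexP _ sL) [_ <-] /(has_indexP _ sL) [_ <-]. Qed.

Lemma has_index_gt0 (G : zmodType) (L : set G) m : has_index L m -> (0 < m)%N.
Proof. by case=> r _; case: (r 0) => i /=; case: (m). Qed.

Lemma has_index_finType (G : zmodType) (L : set G) (T : finType) (r : G -> T) :
    (forall i, exists x, r x = i) -> (forall x y, r x = r y <-> L (x - y)) ->
  has_index L #|T|.
Proof.
move=> rS rP; exists (fun x => enum_rank (r x)); split=> [i|x y].
  by have [x e] := rS (enum_val i); exists x; rewrite e enum_valK.
by rewrite -rP; split=> [/enum_rank_inj|->].
Qed.

(** Corestricting the labelling to its image makes it surjective. This serves for a slice of a
    subgroup of finite index, where the restricted labels may miss some values. *)
Lemma has_index_ex (G : zmodType) (L : set G) (T : finType) (r : G -> T) :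
  (forall x y, r x = r y <-> L (x - y)) -> exists m, has_index L m.
Proof.
move=> rP; pose P t := `[< exists x, r x = t >].
have rx x : P (r x) by apply/asboolP; exists x.
exists #|{: {t : T | P t}}|.
apply: (@has_index_finType _ _ _ (fun x => exist P (r x) (rx x))) => [[t Pt]|x y].
  by have /asboolP[x e] := Pt; exists x; apply: val_inj.
by rewrite -rP; split=> [[]|e] //; apply: val_inj.
Qed.

Lemma divzB_eqmod (d k l : int) : d != 0 -> (k = l %[mod d])%Z ->
  ((k - l) %/ d)%Z = (k %/ d)%Z - (l %/ d)%Z.
Proof.
move=> d0 hm; have -> : k - l = ((k %/ d)%Z - (l %/ d)%Z) * d.
  by rewrite {1}(divz_eq k d) {1}(divz_eq l d) hm; ring.
by rewrite mulzK.
Qed.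

Lemma subMzB (G : zmodType) (x y v : G) (a b : int) :
  x - y - v *~ (a - b) = (x - v *~ a) - (y - v *~ b).
Proof. by rewrite mulrzBr !opprD !opprK addrACA. Qed.

(** * Subgroups of finite index of [G * int] *)

Section Lift.
Variable G : zmodType.
Implicit Types (L : set (G * int)) (K : set G).

(** For [d > 0] and a subgroup [K], this is the subgroup generated by [K * 0] and [(v, d)], put as a
    membership test. *)
Definition lift_subgroup (d : nat) K (v : G) : set (G * int) :=
  [set u | (d %| u.2)%Z /\ K (u.1 - v *~ (u.2 %/ d)%Z)].

Lemma lift_subgroupP d K v : (0 < d)%N -> is_subgroup K ->
  is_subgroup (lift_subgroup d K v).
Proof.
move=> d0 sK; apply: is_subgroupI.
  by split=> /=; [exact: dvdz0 | rewrite div0z mulr0z subr0; exact: subgroup0].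
move=> [x k] [y l] [/= dk Kx] [/= dl Ky]; split=> /=; first exact: rpredB.
rewrite divzB_eqmod ?eqz_nat -?lt0n // ?subMzB; first exact: subgroupB.
by rewrite (dvdz_mod0P dk) (dvdz_mod0P dl).
Qed.

(** Label [(x, k)] by the class of [x - v *~ (k %/ d)] modulo [K] together with the remainder of [k]
    modulo [d]; when remainders agree, the quotient of the difference is the difference of the
    quotients. *)
Lemma lift_subgroup_index d K v e : (0 < d)%N -> has_index K e ->
  has_index (lift_subgroup d K v) (e * d).
Proof.
case: d => // d _ [r [rS rP]].
have md k : (absz (k %% d.+1)%Z < d.+1)%N.
  have h := modz_ge0 k (isT : d.+1%:Z != 0).
  by rewrite -ltz_nat gez0_abs // ltz_pmod.
have -> : (e * d.+1)%N = #|{: 'I_e * 'I_d.+1}| by rewrite card_prod !card_ord.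
apply: (@has_index_finType _ _ _ (fun u : G * int =>
  (r (u.1 - v *~ (u.2 %/ d.+1)%Z), Ordinal (md u.2)))).
  move=> [i j]; have [x rx] := rS i; exists (x, j%:Z) => /=.
  rewrite divz_small ?ltz_nat ?ltn_ord // mulr0z subr0 rx; congr pair.
  by apply: val_inj; rewrite /= modz_small // ltz_nat ltn_ord.
move=> [x k] [y l] /=.
split.
  case=> /rP h1 h2.
  have hm : (k = l %[mod d.+1])%Z.
    by rewrite -[LHS]gez0_abs ?modz_ge0 // h2 gez0_abs ?modz_ge0.
  split=> /=; first by rewrite -eqz_mod_dvd; apply/eqP.
  by rewrite divzB_eqmod // subMzB.
case=> /=; rewrite -eqz_mod_dvd => /eqP hm.
rewrite divzB_eqmod // subMzB => /rP ->; congr pair; apply: val_inj => /=.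
by rewrite hm.
Qed.

Lemma pairMz (x : G) (k l : int) : (x, k) *~ l = (x *~ l, k * l).
Proof.
have h n : (x, k) *+ n = (x *+ n, k *+ n).
  by elim: n => [|n IH]; rewrite ?mulr0n // !mulrS IH.
case: l => n; first by rewrite -[LHS]/((x, k) *+ n) h -mulr_natr natz.
by rewrite -[LHS]/(- ((x, k) *+ n.+1)) h -mulr_natr natz NegzE mulrN.
Qed.

(** Take for [d] the least positive second coordinate in [L], for [v] a companion of it, and for [K]
    the slice at second coordinate 0; subtracting a multiple of [(v, d)] moves any element of [L]
    into that slice. *)
Lemma lift_subgroup_ex L m : is_subgroup L -> has_index L m ->
  exists d e K v, [/\ (0 < d)%N, is_subgroup K, has_index K e,
    L = lift_subgroup d K v & m = (e * d)%N].
Proof.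
move=> sL iL; have [r [rS rP]] := iL.
pose P d := (0 < d)%N && `[< exists x, L (x, d%:Z) >].
have exP : exists d, P d.
  (* Pigeonhole: [m.+1] elements [(0, i)] share [m] labels, so two of them differ by an element of
     [L]. *)
  have : ~ injective (fun i : 'I_m.+1 => r (0, (i : nat)%:Z)).
    by move=> /leq_card; rewrite !card_ord ltnn.
  move/existsNP => [i /existsNP [j /not_implyP [/rP]]].
  wlog lt_ij : i j / (j < i)%N.
    move=> H h ne; case: (ltngtP j i) => [ji|ij|/val_inj e].
    - exact: (H i j).
    - by apply: (H j i) => //; [rewrite -opprB; exact: subgroupN | exact/nesym].
    - by case: ne.
  move=> h _; exists (i - j)%N; rewrite /P subn_gt0 lt_ij; apply/asboolP.
  exists 0; have -> : (0, (i - j)%N%:Z) = (0, i%:Z) - (0, j%:Z) :> G * int.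
    by congr pair; rewrite ?subrr // -subzn // ltnW.
  exact: h.
have [d /andP[d0 /asboolP[v Lv]] dmin] := ex_minnP exP.
have dn0 : d%:Z != 0 by rewrite eqz_nat -lt0n.
(* A nonzero remainder would be a positive second coordinate smaller than [d]. *)
have hd x k : L (x, k) -> (d %| k)%Z.
  move=> Lx; have : L (x - v *~ (k %/ d)%Z, (k %% d)%Z).
    have -> : (x - v *~ (k %/ d)%Z, (k %% d)%Z) = (x, k) - (v, d%:Z) *~ (k %/ d)%Z.
      by rewrite pairMz; congr pair; rewrite {2}(divz_eq k d) /=; ring.
    by apply: subgroupB => //; exact: subgroupMz.
  have : (k %% d)%Z < d by rewrite ltz_pmod // ltz_nat.
  have := modz_ge0 k dn0; case E : (k %% d)%Z => [q|//] _; rewrite ltz_nat => qd Lq.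
  apply/dvdz_mod0P; rewrite E; case: (posnP q) => [->//|q0].
  have : P q by rewrite /P q0; apply/asboolP; eexists; exact: Lq.
  by move/dmin; rewrite leqNgt qd.
pose K := [set x : G | L (x, 0)].
have sK : is_subgroup K.
  by apply: is_subgroupI; [exact: (subgroup0 sL) | move=> x y; exact: (subgroupB sL)].
have [e eK] : exists e, has_index K e.
  by apply: (@has_index_ex _ _ _ (fun x => r (x, 0))) => x y; exact: rP.
have EL : L = lift_subgroup d K v.
  apply/seteqP; split=> [[x k] Lx|[x k] [/= dk Kx]].
    have dk := hd _ _ Lx; split=> //.
    change (L (x - v *~ (k %/ d)%Z, 0)).
    have -> : (x - v *~ (k %/ d)%Z, 0%R) = (x, k) - (v, d%:Z) *~ (k %/ d)%Z.
      by rewrite pairMz; congr pair; rewrite /= [d%:Z * _]mulrC divzK // subrr.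
    by apply: subgroupB => //; exact: subgroupMz.
  have -> : (x, k) = (x - v *~ (k %/ d)%Z, 0%R) + (v, d%:Z) *~ (k %/ d)%Z.
    by rewrite pairMz; congr pair; rewrite /= ?subrK // add0r mulrC divzK.
  by apply: subgroupD => //; exact: subgroupMz.
exists d, e, K, v; split=> //.
apply: (has_index_unique sL iL); rewrite EL; exact: lift_subgroup_index.
Qed.

(** Each lift contains its own [(v, d)], so [d] and [d'] divide each other; the slice at second
    coordinate 0 recovers [K], and testing [(v, d)] in the other lift compares [v] with [v']. *)
Lemma lift_subgroup_inj d d' K K' v v' : (0 < d)%N -> (0 < d')%N ->
    is_subgroup K -> is_subgroup K' ->
    lift_subgroup d K v = lift_subgroup d' K' v' ->
  [/\ d = d', K = K' & K (v - v')].
Proof.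
move=> d0 d0' sK sK' E.
have self c J w : (0 < c)%N -> is_subgroup J -> lift_subgroup c J w (w, c%:Z).
  move=> c0 sJ; split=> /=; first exact: dvdzz.
  by rewrite divzz eqz_nat -lt0n c0 mulr1z subrr; exact: subgroup0.
have ed : d = d'.
  have [/= h1 _] : lift_subgroup d K v (v', d'%:Z) by rewrite E; exact: self.
  have [/= h2 _] : lift_subgroup d' K' v' (v, d%:Z) by rewrite -E; exact: self.
  by apply/eqP; rewrite eqn_dvd; apply/andP; split.
have eK : K = K'.
  have z c J w x : lift_subgroup c J w (x, 0) <-> J x.
    by rewrite /lift_subgroup /= div0z mulr0z subr0 dvdz0; split=> [[]|].
  apply/seteqP; split=> x.
    by move/(z d K v); rewrite E => /z.
  by move/(z d' K' v'); rewrite -E => /z.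
split=> //; subst d' K'.
have [/= _] : lift_subgroup d K v' (v, d%:Z) by rewrite -E; exact: self.
by rewrite divzz eqz_nat -lt0n d0 mulr1z.
Qed.

End Lift.

(** * The recurrence for the number of subgroups of given index *)

Definition subgroups_of_index (G : zmodType) (m : nat) : set (set G) :=
  [set L | is_subgroup L /\ has_index L m].
Arguments subgroups_of_index : clear implicits.

(** Enumeration by an arbitrary [finType] reduces the counting of unions and fibrations to cardinals
    of sum and sigma types. *)
Definition has_card (U : Type) (S : set U) (N : nat) : Prop :=
  exists (T : finType) (f : T -> U), [/\ injective f, S = range f & #|T| = N].

Lemma has_card_fset_set (U : choiceType) (S : set U) N :
  has_card S N -> finite_set S /\ #|` fset_set S| = N.
Proof. by case=> T [f [fI e <-]]; exact: card_fset_set_range e. Qed.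

Lemma has_card0 (U : Type) : has_card (@set0 U) 0.
Proof.
exists void, (fun v : void => match v with end); split; [by case | | by rewrite card_void].
by apply/seteqP; split=> // x [[]].
Qed.

Lemma has_card1 (U : Type) (x : U) : has_card [set x] 1.
Proof.
exists unit, (fun=> x); split; [by case=> [] [] | | by rewrite card_unit].
by apply/seteqP; split=> [_ -> | _ [_ _ <-]] //; exists tt.
Qed.

Lemma has_card_image (U V : Type) (g : U -> V) (S : set U) N :
  injective g -> has_card S N -> has_card (g @` S) N.
Proof.
move=> gI [T [f [fI -> <-]]]; exists T, (g \o f); split=> //; first exact: inj_comp.
by rewrite image_comp.
Qed.

Lemma has_index_section (G : zmodType) (K : set G) e : is_subgroup K -> has_index K e ->
  exists s : 'I_e -> G,
    (forall i j, K (s i - s j) -> i = j) /\ (forall v, exists i, K (v - s i)).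
Proof.
move=> sK [r [rS rP]]; have [s sP] := choice rS.
exists s; split=> [i j /rP | v]; first by rewrite !sP.
by exists (r v); apply/rP; rewrite sP.
Qed.

Lemma lift_subgroup_eq (G : zmodType) (d : nat) (K : set G) (v w : G) : is_subgroup K ->
  K (v - w) -> lift_subgroup d K v = lift_subgroup d K w.
Proof.
move=> sK Kvw.
have h a b c : K (a - b) -> K (c - a) -> K (c - b).
  by move=> Kab Kca; have := subgroupD sK Kca Kab; rewrite addrA subrK.
have hz a b q : K (a - b) -> K (a *~ q - b *~ q).
  by rewrite -mulrzBl; exact: subgroupMz.
have hs a b : K (a - b) -> K (b - a) by rewrite -(opprB b a) => /(subgroupN sK); rewrite opprK.
have key x a b q : K (a - b) -> K (x - a *~ q) -> K (x - b *~ q).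
  by move=> /(hz _ _ q); exact: h.
by apply/seteqP; split=> -[x k] [/= dk Kx]; split=> //=; apply: key Kx => //; exact: hs.
Qed.

(* The fibres over [e] are empty unless [e] divides [m], so the index type is a
   sigma type over all [e <= m] with possibly empty fibres. *)
Lemma has_card_subgroups_pair (G : zmodType) (a : nat -> nat) m :
    (forall e, (0 < e)%N -> has_card (subgroups_of_index G e) (a e)) -> (0 < m)%N ->
  has_card (subgroups_of_index (G * int)%type m) (\sum_(e < m.+1 | (e %| m)%N) a e * e)%N.
Proof.
move=> ha m0.
have H (e : 'I_m.+1) : exists Tf : {T : finType & T -> set G},
    [/\ injective (projT2 Tf),
        [set L | (e %| m)%N /\ subgroups_of_index G e L] = range (projT2 Tf) &
        #|projT1 Tf| = if (e %| m)%N then a e else 0%N].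
  case: ifP => em.
    have [T [f [fI fE fN]]] := ha e (dvdn_gt0 m0 em).
    exists (existT _ T f); split=> //=; rewrite -fE.
    by apply/seteqP; split=> L //= [].
  have [T [f [fI fE fN]]] := has_card0 (set G).
  exists (existT _ T f); split=> //=; rewrite -fE.
  by apply/seteqP; split=> L //= [].
have [Tf HT] := choice H.
pose T e := projT1 (Tf e); pose f e : T e -> set G := projT2 (Tf e).
have fP e (t : T e) : [/\ (e %| m)%N, is_subgroup (f e t) & has_index (f e t) e].
  have [_ E _] := HT e; suff [? []] : [set L | (e %| m)%N /\ subgroups_of_index G e L] (f e t) by [].
  by rewrite E; exists t.
have Hs (x : {e : 'I_m.+1 & T e}) : exists s : 'I_(tag x) -> G,
    (forall i j, f _ (tagged x) (s i - s j) -> i = j) /\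
    (forall v, exists i, f _ (tagged x) (v - s i)).
  by have [_ h1 h2] := fP _ (tagged x); exact: has_index_section.
pose s e (t : T e) : 'I_e -> G := projT1 (cid (Hs (Tagged T t))).
have sI e t i j : f e t (s e t i - s e t j) -> i = j.
  by rewrite /s; case: cid => /= s' [h _]; exact: h.
have sS e t v : exists i, f e t (v - s e t i).
  by rewrite /s; case: cid => /= s' [_ h]; exact: h.
(* A subgroup of index [m] is coded by [e], a subgroup of index [e], and one of [e] coset
   representatives; the remaining parameter is forced to be [m %/ e]. *)
pose F (x : {e : 'I_m.+1 & (T e * 'I_e)%type}) : set (G * int) :=
  lift_subgroup (m %/ tag x) (f _ (tagged x).1) (s _ (tagged x).1 (tagged x).2).
have q0 e (t : T e) : (0 < m %/ e)%N.
  by have [em _ _] := fP e t; rewrite divn_gt0 ?(dvdn_gt0 m0) // dvdn_leq.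
exists {e : 'I_m.+1 & (T e * 'I_e)%type}, F; split.
- move=> [e [t i]] [e' [t' i']]; rewrite /F /= => E.
  have [em h1 h2] := fP _ t; have [em' h1' h2'] := fP _ t'.
  have [ed eK Kv] := lift_subgroup_inj (q0 _ t) (q0 _ t') h1 h1' E.
  have ee : e = e'.
    apply: val_inj; apply/eqP => /=; rewrite -(eqn_pmul2l (q0 _ t)).
    by rewrite {2}ed !divnK.
  subst e'.
  have et : t = t' by have [fI _ _] := HT e; exact: fI.
  by subst t'; rewrite (sI _ _ _ _ Kv).
- apply/seteqP; split=> [L [sL iL]|_ [[e [t i]] _ <-]]; last first.
    have [em h1 h2] := fP _ t; rewrite /F /=; split; first exact: lift_subgroupP (q0 _ t) h1.
    by have := lift_subgroup_index (s _ t i) (q0 _ t) h2; rewrite mulnC divnK.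
  have [d [e [K [v [d0 sK iK -> em]]]]] := lift_subgroup_ex sL iL.
  have lt_em : (e < m.+1)%N by rewrite ltnS em leq_pmulr.
  have e0 : (0 < e)%N := has_index_gt0 iK.
  have [_ E _] := HT (Ordinal lt_em).
  have : [set L | (Ordinal lt_em %| m)%N /\ subgroups_of_index G (Ordinal lt_em) L] K.
    by split=> //=; rewrite em dvdn_mulr.
  rewrite E => -[t _ ft]; have [i Ki] := sS _ t v.
  exists (existT _ (Ordinal lt_em) (t, i)) => //; rewrite /F /=.
  rewrite {1}em mulKn //; rewrite -/(f _ t) in ft; rewrite ft in Ki *.
  by apply/esym; exact: lift_subgroup_eq.
- rewrite card_tagged sumnE big_map big_enum /= [RHS]big_mkcond /=.
  apply: eq_bigr => e _; rewrite card_prod card_ord; have [_ _ ->] := HT e.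
  by case: ifP.
Qed.

Lemma has_card_subgroups_iso (G H : zmodType) (g : G -> H) (h : H -> G) m N :
    cancel g h -> cancel h g -> {morph g : x y / x - y} ->
  has_card (subgroups_of_index G m) N -> has_card (subgroups_of_index H m) N.
Proof.
move=> gK hK gB; have hB : {morph h : x y / x - y}.
  by move=> x y; apply: (can_inj gK); rewrite gB !hK.
have pre (A B : zmodType) (u : A -> B) (u' : B -> A) (L : set B) :
    cancel u u' -> cancel u' u -> {morph u : x y / x - y} ->
    subgroups_of_index B m L -> subgroups_of_index A m (u @^-1` L).
  move=> uK uK' uB [sL [r [rS rP]]]; split.
    apply: is_subgroupI; last by move=> x y; rewrite /preimage /= uB; exact: subgroupB.
    by rewrite /preimage /= -(subrr 0) uB subrr; exact: subgroup0.
  exists (r \o u); split=> [i|x y]; last by rewrite /= rP /preimage /= uB.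
  by have [x e] := rS i; exists (u' x); rewrite /= uK'.
move=> /(@has_card_image _ _ (fun L => h @^-1` L)) => C.
have -> : subgroups_of_index H m = (fun L => h @^-1` L) @` subgroups_of_index G m.
  apply/seteqP; split=> [L SL|_ [L SL <-]]; last exact: pre SL.
  exists (g @^-1` L); first exact: pre SL.
  by apply/seteqP; split=> x; rewrite /preimage /= hK.
apply: C => L L' E; apply/seteqP; split=> x.
  by have := congr1 (fun S => S (g x)) E; rewrite /preimage /= gK => ->.
by have := congr1 (fun S => S (g x)) E; rewrite /preimage /= gK => ->.
Qed.

(** The term [e = 0] carries a factor 0. The base case reflects that the trivial group has a single
    subgroup, of index 1. *)
Fixpoint num_sublattices (n m : nat) : nat :=
  if n is n'.+1 then (\sum_(e < m.+1 | (e %| m)%N) num_sublattices n' e * e)%N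
  else (m == 1)%N.

Lemma has_card_sublattices (n m : nat) : (0 < m)%N ->
  has_card (subgroups_of_index 'rV[int]_n m) (num_sublattices n m).
Proof.
elim: n m => [|n IH] m m0 /=.
  have triv (L : set 'rV[int]_0) : is_subgroup L -> L = setT.
    move=> sL; apply/seteqP; split=> // x _.
    by rewrite (_ : x = 0); [exact: subgroup0 | apply/rowP; case].
  have iT : has_index [set: 'rV[int]_0] 1.
    by exists (fun=> ord0); split=> [i|x y]; [exists 0; rewrite [i]ord1 | split].
  have sT : is_subgroup [set: 'rV[int]_0] by exact: is_subgroupI.
  have [->|m1] := eqVneq m 1%N.
    suff -> : subgroups_of_index 'rV[int]_0 1 = [set setT] by exact: has_card1.
    apply/seteqP; split=> [L [/triv]|L ->] //.
  suff -> : subgroups_of_index 'rV[int]_0 m = set0 by exact: has_card0.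
  apply/seteqP; split=> // L [sL]; rewrite (triv _ sL) => iL.
  by move/eqP: m1; apply; exact: has_index_unique sT iL iT.
(* Splitting off the first coordinate identifies [Z^(n+1)] with [Z^n * Z]. *)
pose g (u : 'rV[int]_n * int) : 'rV[int]_n.+1 :=
  row_mx (u.2)%:M u.1 : 'rV_(1 + n).
pose h (x : 'rV[int]_n.+1) : 'rV[int]_n * int := (rsubmx (x : 'rV_(1 + n)), x 0 0).
apply: (@has_card_subgroups_iso _ _ g h); last exact: has_card_subgroups_pair.
- move=> [x k]; rewrite /h /g /= row_mxKr; congr pair.
  by rewrite mxE; case: splitP => // j _; rewrite !ord1 mxE.
- move=> x; rewrite /h /g /=.
  have -> : (x 0 0)%:M = lsubmx (x : 'rV_(1 + n)).
    by apply/rowP => i; rewrite !mxE !ord1 mulr1n; congr (x _ _); exact: val_inj.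
  exact: (@hsubmxK _ 1 1 n x).
- move=> [x k] [y l]; apply/rowP => i; rewrite /g /= !mxE.
  by case: splitP => j _; rewrite !mxE ?ord1 // mulrnBl.
Qed.

Lemma has_cardU (U : Type) (A B : set U) a b :
  has_card A a -> has_card B b -> A `&` B = set0 -> has_card (A `|` B) (a + b).
Proof.
move=> [T [f [fI -> <-]]] [T' [f' [f'I -> <-]]] AB0.
have dis x y : f x <> f' y.
  by move=> e; have : set0 (f x) by rewrite -AB0; split; [exists x | exists y].
exists (T + T')%type, (fun u => match u with inl x => f x | inr y => f' y end); split.
- move=> [x|x] [y|y] // e; first by rewrite (fI _ _ e).
  + by case: (dis x y).
  + by case: (dis y x).
  + by rewrite (f'I _ _ e).
- apply/seteqP; split=> [_ [] [x _ <-]|_ [[x|x] _ <-]].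
  + by exists (inl x).
  + by exists (inr x).
  + by left; exists x.
  + by right; exists x.
- by rewrite card_sum.
Qed.

Lemma squarefree_gt0 m : squarefree m -> (0 < m)%N.
Proof. by case: m => // /(_ 2%N (dvdn0 _)). Qed.

Definition squarefree_sum (n N : nat) : nat :=
  (\sum_(1 <= m < N.+1 | `[< squarefree m >]) num_sublattices n m)%N.

(** The set is built up one index at a time; uniqueness of the index makes the pieces disjoint. *)
Lemma has_card_squarefree (n N : nat) :
  has_card [set L : set 'rV[int]_n | exists m, [/\ (m <= N)%N, squarefree m
                                        & subgroups_of_index 'rV[int]_n m L]]
    (squarefree_sum n N).
Proof.
rewrite /squarefree_sum; elim: N => [|N IH].
  rewrite big_geq //; set S := mkset _; suff -> : S = set0 by exact: has_card0.
  apply/seteqP; split=> // L [m []].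
  by rewrite leqn0 => /eqP -> /squarefree_gt0.
rewrite big_mkcond /= big_nat_recr //= -big_mkcond /=; set S := mkset _ in IH.
have [sN|nsN] := asboolP (squarefree N.+1); last first.
  rewrite addn0; set S' := mkset _; suff -> : S' = S by [].
  apply/seteqP; split=> L [m [le_m sm Lm]]; exists m; split=> //; last exact: leqW.
  by move: le_m; rewrite leq_eqVlt => /orP[/eqP e|//]; subst m.
rewrite (_ : mkset _ = S `|` subgroups_of_index 'rV[int]_n N.+1).
  apply: has_cardU => //; first exact: has_card_sublattices.
  apply/seteqP; split=> // L [[m [le_m _ [sL iL]]] [_ iL']].
  by move: le_m; rewrite (has_index_unique sL iL iL') ltnn.
apply/seteqP; split=> L.
  move=> [m [le_m sm Lm]]; move: le_m; rewrite leq_eqVlt => /orP[/eqP e|le_m].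
    by right; subst m.
  by left; exists m.
case=> [[m [le_m sm Lm]]|LN]; [exists m; split=> //; exact: leqW | by exists N.+1].
Qed.

Lemma Nsharp_squarefree_sum (R : realType) (n : nat) (V : R) : 0 <= V ->
  Nsharp n V = squarefree_sum n (Num.truncn V).
Proof.
move=> V0; rewrite /Nsharp.
suff -> : @squarefree_sublattices R n V =
    [set L : set 'rV[int]_n | exists m, [/\ (m <= Num.truncn V)%N, squarefree m
                                        & subgroups_of_index 'rV[int]_n m L]].
  by have [_ ->] := has_card_fset_set (has_card_squarefree n (Num.truncn V)).
apply/seteqP; split=> [L [sL fL le_V sf]|L [m [le_m sm [sL iL]]]].
  exists (subgroup_index L); rewrite Num.Theory.truncn_ge_nat //; split=> //.
  by split=> //; apply/has_indexP.
have [fL e] := proj1 (has_indexP m sL) iL.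
by split=> //; rewrite e // -Num.Theory.truncn_ge_nat.
Qed.

(** * Multiplicativity of the count at a new prime *)

Lemma big_multiples (V : Type) (idx : V) (op : Monoid.law idx) (F : nat -> V) d N :
    (0 < d)%N ->
  \big[op/idx]_(1 <= m < N.+1 | (d %| m)%N) F m =
  \big[op/idx]_(1 <= m < (N %/ d).+1) F (d * m)%N.
Proof.
move=> d0; elim: N => [|N IH]; first by rewrite div0n !big_geq.
rewrite big_mkcond big_nat_recr //= -big_mkcond IH divnS //.
case: ifP => dN; last by rewrite Monoid.mulm1 add0n.
rewrite add1n [in RHS]big_nat_recr //=; congr (op _ (F _)).
by have -> : (N %/ d).+1 = (N.+1 %/ d)%N; [rewrite divnS // dN | rewrite mulnC divnK].
Qed.

Lemma num_sublatticesS n m : num_sublattices n.+1 m =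
  (\sum_(1 <= e < m.+1 | e %| m) num_sublattices n e * e)%N.
Proof.
rewrite /= -(big_mkord (fun e => e %| m)%N (fun e => num_sublattices n e * e)%N).
by rewrite big_ltn_cond //= muln0 add0n if_same.
Qed.

(** Induction on [n]: the divisors of [p * m] are the divisors [e] of [m] and the products [p * e].
    In dimension [n.+1] the former contribute the count for [m] once, the latter
    [p * (1 + ... + p^(n-1))] times. *)
Lemma num_sublattices_primeM n p m : prime p -> ~~ (p %| m)%N -> (0 < m)%N ->
  num_sublattices n (p * m) = ((\sum_(i < n) p ^ i) * num_sublattices n m)%N.
Proof.
move=> pp; have p0 := prime_gt0 pp.
elim: n m => [|n IH] m pm m0.
  by rewrite big_ord0 /= muln_eq1; case: eqP pp => // ->.
rewrite !num_sublatticesS (bigID (fun e => p %| e)%N) /= addnC big_ord_recl expn0.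
rewrite mulnDl mul1n; congr addn.
  rewrite [RHS](big_nat_widen _ _ (p * m).+1) ?ltnS ?leq_pmull //.
  rewrite big_mkcond [RHS]big_mkcond; apply: eq_big_nat => e _.
  congr (if _ then _ else _); apply/andP/andP => [[epm pe]|[em _]].
    have em : (e %| m)%N.
      by rewrite -(@Gauss_dvdr _ p) // coprime_sym prime_coprime.
    by rewrite em ltnS dvdn_leq.
  rewrite dvdn_mull //; split=> //.
  by apply: contra pm => pe; exact: dvdn_trans pe em.
rewrite (eq_bigl (fun e => (p %| e) && (e %| p * m))%N) => [|e]; last by rewrite andbC.
rewrite big_mkcondr /=.
rewrite big_multiples // mulKn // big_distrr [RHS]big_mkcond /=; apply: eq_big_nat => e /andP[e0 _].
rewrite dvdn_pmul2l //; case: ifP => // em.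
rewrite IH //; last by apply: contra pm => pe; exact: dvdn_trans pe em.
have -> : (\sum_(i < n) p ^ bump 0 i = p * \sum_(i < n) p ^ i)%N.
  by rewrite big_distrr; apply: eq_bigr => i _; rewrite /= /bump add1n expnS.
by rewrite -!mulnA [RHS]mulnCA (mulnCA _ p).
Qed.

(** * Sieving the sum over squarefree indices *)

Section LocalFactors.
Variables (R : realType) (n : nat).

(** This is [1 + p + ... + p^(n-1)] divided by [p^(n-1)]: the local factor of the count after
    normalisation by [m^(n-1)]. *)
Definition psigma (p : nat) : R := \sum_(i < n) p%:R ^- i.

Definition local_weight (p m : nat) : R :=
  if (p * p %| m)%N then 0 else if (p %| m)%N then psigma p else 1.

Definition sieve_weight (y m : nat) : R := \prod_(0 <= p < y | prime p) local_weight p m.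

Definition sieve_sum (y N : nat) : R :=
  \sum_(1 <= m < N.+1) m%:R ^+ n.-1 * sieve_weight y m.

(** Linearity in the indicators of divisibility by [p] and [p * p] lets a weighted sum split into
    sums over multiples. *)
Lemma local_weightE p m : local_weight p m =
  1 + (psigma p - 1) *+ (p %| m)%N - psigma p *+ (p * p %| m)%N.
Proof.
rewrite /local_weight; case: ifP => [/(dvdn_trans (dvdn_mulr p (dvdnn p))) ->|_].
  by rewrite !mulr1n; ring.
by case: ifP => _; rewrite ?mulr1n ?mulr0n; ring.
Qed.

Lemma local_weight_primeM p q m : prime p -> prime q -> p != q ->
  local_weight q (p * m) = local_weight q m.
Proof.
move=> pp pq npq; have cpq : coprime q p.
  by rewrite prime_coprime // dvdn_prime2 // eq_sym.
by rewrite /local_weight !Gauss_dvdr // coprimeMl cpq.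
Qed.

Lemma sieve_weight_primeM_ge y p m : prime p -> (y <= p)%N ->
  sieve_weight y (p * m) = sieve_weight y m.
Proof.
move=> pp yp; rewrite /sieve_weight big_nat_cond [RHS]big_nat_cond.
apply: eq_bigr => q /andP[/andP[_ qy] pq].
by apply: local_weight_primeM => //; rewrite gtn_eqF // (leq_trans qy).
Qed.

Lemma sieve_weight_recr y m :
  sieve_weight y.+1 m = sieve_weight y m * (if prime y then local_weight y m else 1).
Proof. by rewrite /sieve_weight big_mkcond big_nat_recr //= -big_mkcond. Qed.

(** Only the local weight at [p] changes, from 1 to [psigma p]; the other primes do not see the
    factor [p]. *)
Lemma sieve_weight_primeM_lt y p m : prime p -> (p < y)%N -> ~~ (p %| m)%N ->
  sieve_weight y (p * m) = psigma p * sieve_weight y m.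
Proof.
move=> pp + pm; elim: y => // y IH; rewrite ltnS leq_eqVlt => /orP[/eqP <-|py].
  rewrite !sieve_weight_recr pp sieve_weight_primeM_ge // mulrC; congr (_ * _).
  rewrite /local_weight dvdn_pmul2l ?prime_gt0 // (negPf pm) dvdn_mulr //.
  have npp : (p * p %| m)%N = false.
    by apply: contraNF pm; apply: dvdn_trans; exact: dvdn_mulr.
  by rewrite /local_weight npp (negPf pm) mulr1.
rewrite !sieve_weight_recr IH // -mulrA; congr (_ * (_ * _)).
by case: ifP => // pyy; rewrite local_weight_primeM // ltn_eqF.
Qed.

Lemma sieve_weight_eq0 y p m : prime p -> (p < y)%N -> (p * p %| m)%N ->
  sieve_weight y m = 0.
Proof.
move=> pp py ppm; apply/eqP; rewrite prodf_seq_eq0; apply/hasP; exists p.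
  by rewrite mem_index_iota.
by rewrite pp /local_weight ppm eqxx.
Qed.

Lemma sieve_weight1 y : sieve_weight y 1 = 1.
Proof.
apply: big1 => p pp; rewrite /local_weight !dvdn1 muln_eq1 andbb.
by case: eqP pp => // ->.
Qed.

Lemma psigmaE p : (0 < n)%N -> (0 < p)%N ->
  ((\sum_(i < n) p ^ i)%N)%:R = p%:R ^+ n.-1 * psigma p :> R.
Proof.
move=> n0 p0; rewrite /psigma mulr_sumr natr_sum (reindex_inj rev_ord_inj) /=.
apply: eq_bigr => i _; rewrite natrX -expfB_cond ?pnatr_eq0 -?lt0n ?p0 //=.
  by congr (_ ^+ _); case: i => i /=; lia.
by case: i => i /=; lia.
Qed.

(** Strong induction, removing the least prime divisor of [m] from both sides; [m < y] ensures that
    every prime divisor of [m] has been sieved. *)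
Lemma num_sublattices_weight y m : (0 < n)%N -> squarefree m -> (m < y)%N ->
  (num_sublattices n m)%:R = m%:R ^+ n.-1 * sieve_weight y m :> R.
Proof.
move=> n0; elim/ltn_ind: m => m IH sm my; have m0 := squarefree_gt0 sm.
have [m1|m1] := leqP m 1.
  have -> : m = 1%N by apply/eqP; rewrite eqn_leq m1.
  rewrite sieve_weight1 expr1n mulr1.
  suff -> : num_sublattices n 1 = 1%N by [].
  move=> {n0 IH}; elim: n => // k IH; rewrite num_sublatticesS.
  by rewrite big_mkcond big_nat1 dvd1n IH.
pose p := pdiv m; have pp : prime p := pdiv_prime m1.
have [q mq] := dvdnP (pdiv_dvd m); rewrite mulnC -/p in mq.
have q0 : (0 < q)%N by move: m0; rewrite mq muln_gt0 => /andP[].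
have npq : ~~ (p %| q)%N.
  (* Otherwise the square of [p] would divide [m]. *)
  apply/negP => /dvdnP[t qt].
  have := sm p; rewrite mq qt mulnCA mulnn dvdn_mull // => /(_ isT) p1.
  by move: pp; rewrite p1.
have sq : squarefree q.
  by move=> d dq; apply: sm; rewrite mq dvdn_mull.
have qm : (q < m)%N by rewrite mq ltn_Pmull // prime_gt1.
have pm : (p < y)%N by apply: leq_ltn_trans my; rewrite mq leq_pmulr.
rewrite mq num_sublattices_primeM // sieve_weight_primeM_lt // natrM psigmaE ?(prime_gt0 pp) //.
rewrite IH //; last exact: ltn_trans my.
by rewrite natrM exprMn; ring.
Qed.

Lemma sieve_weight_nsqf y m : (0 < m)%N -> ~ squarefree m -> (m < y)%N ->
  sieve_weight y m = 0.
Proof.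
move=> m0 /existsNP[d /not_implyP[dm d1]] my.
have d0 : (0 < d)%N by case: d dm {d1} => //; rewrite dvd0n => /eqP m0'; rewrite m0' in m0.
have d2 : (1 < d)%N by case: d d0 d1 {dm} => [|[]].
have pd := pdiv_dvd d; have ppm : (pdiv d * pdiv d %| m)%N.
  by apply: dvdn_trans dm; rewrite -mulnn; exact: dvdn_mul.
apply: (sieve_weight_eq0 (pdiv_prime d2)) => //.
apply: leq_ltn_trans my; apply: dvdn_leq => //.
exact: dvdn_trans (dvdn_mulr _ (dvdnn _)) ppm.
Qed.

(** Level [N.+1] exceeds every [m <= N], so the sieve is complete on the range; the count is thus a
    diagonal value of [sieve_sum]. *)
Lemma squarefree_sumE N : (0 < n)%N ->
  (squarefree_sum n N)%:R = sieve_sum N.+1 N.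
Proof.
move=> n0; rewrite /squarefree_sum natr_sum big_mkcond; apply: eq_big_nat => m /andP[m0 mN].
by case: asboolP => [sm|nsm]; [exact: num_sublattices_weight | rewrite sieve_weight_nsqf ?mulr0].
Qed.

Lemma sum_multiples_weight y d N : (0 < d)%N ->
    (forall m, sieve_weight y (d * m) = sieve_weight y m) ->
  \sum_(1 <= m < N.+1 | (d %| m)%N) m%:R ^+ n.-1 * sieve_weight y m =
  d%:R ^+ n.-1 * sieve_sum y (N %/ d).
Proof.
move=> d0 dy; rewrite big_multiples // mulr_sumr; apply: eq_bigr => m _.
by rewrite dy natrM exprMn mulrA.
Qed.

(** Expand the local weight at [p] by [local_weightE]; the weights at primes below [p] ignore
    factors [p], so the sums over multiples of [p] and [p * p] are dilated copies of the same sieve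
    sum. *)
Lemma sieve_sum_recr p N : prime p ->
  sieve_sum p.+1 N = sieve_sum p N
    + (psigma p - 1) * (p%:R ^+ n.-1 * sieve_sum p (N %/ p))
    - psigma p * ((p * p)%:R ^+ n.-1 * sieve_sum p (N %/ (p * p))).
Proof.
move=> pp; have p0 := prime_gt0 pp; have wp m := @sieve_weight_primeM_ge p p m pp (leqnn p).
rewrite -!sum_multiples_weight ?muln_gt0 ?p0 //; last by move=> m; rewrite -mulnA !wp.
rewrite [X in _ + _ * X - _]big_mkcond [X in _ - _ * X]big_mkcond /sieve_sum !mulr_sumr.
rewrite -big_split -sumrB; apply: eq_bigr => m _ /=.
rewrite sieve_weight_recr pp local_weightE.
by case: (p %| m)%N; case: (p * p %| m)%N; rewrite ?mulr1n ?mulr0n; ring.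
Qed.

Lemma sieve_sum_recr_nprime y N : ~~ prime y -> sieve_sum y.+1 N = sieve_sum y N.
Proof.
by move=> /negPf py; apply: eq_bigr => m _; rewrite sieve_weight_recr py mulr1.
Qed.

Lemma sieve_sum0 N : sieve_sum 0 N = \sum_(1 <= m < N.+1) m%:R ^+ n.-1.
Proof. by apply: eq_bigr => m _; rewrite /sieve_weight big_geq // mulr1. Qed.

End LocalFactors.

(** * Bounds on the sieve sums, uniform in [N] *)

Section SieveBounds.
Variables (R : realType) (n : nat).
Hypothesis n_gt0 : (0 < n)%N.

Local Notation psig := (psigma R n).
Local Notation wt := (sieve_weight R n).
Local Notation S := (sieve_sum R n).

Lemma psigma_ge1 p : 1 <= psig p.
Proof.
rewrite /psigma; case: n n_gt0 => // k _; rewrite big_ord_recl expr0 invr1 lerDl.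
by apply: sumr_ge0 => i _; rewrite invr_ge0 exprn_ge0.
Qed.

Lemma psigma_ge0 p : 0 <= psig p.
Proof. exact: le_trans (psigma_ge1 p). Qed.

Lemma psigmaM p : psig p * (1 - p%:R^-1) = 1 - p%:R ^- n.
Proof.
rewrite /psigma -exprVn -opprB -[RHS]opprB subrX1 mulrN mulrC; congr (- (_ * _)).
by apply: eq_bigr => i _; rewrite exprVn.
Qed.

Lemma psigma_le p : (1 < p)%N -> psig p <= p%:R / (p%:R - 1).
Proof.
move=> p1; have p1' : (1 : R) < p%:R by rewrite ltr1n.
have p0 : (0 : R) < p%:R by exact: lt_trans p1'.
have h : 0 < 1 - p%:R^-1 :> R by rewrite subr_gt0 invf_lt1.
have -> : p%:R / (p%:R - 1) = (1 - p%:R^-1)^-1 :> R.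
  by field; rewrite ?gt_eqF //= subr_gt0.
rewrite -[leRHS]mul1r ler_pdivlMr // psigmaM lerBlDr lerDl invr_ge0 exprn_ge0 //.
Qed.

Lemma sieve_weight_ge0 y m : 0 <= wt y m.
Proof.
apply: prodr_ge0 => p _; rewrite /local_weight.
by case: ifP => // _; case: ifP => // _; exact: psigma_ge0.
Qed.

Lemma sieve_sum_ge0 y N : 0 <= S y N.
Proof. by apply: sumr_ge0 => m _; rewrite mulr_ge0 ?exprn_ge0 ?sieve_weight_ge0. Qed.

(** Since [d * (N %/ d) <= N], the factor [d^(n-1)] absorbs all but one of the [n] powers of [d],
    leaving a gain of [1/d]. *)
Lemma scaled_bound (c s : R) d N : (0 < d)%N -> 0 <= c -> s <= c * (N %/ d)%N%:R ^+ n ->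
  d%:R ^+ n.-1 * s <= c * N%:R ^+ n / d%:R.
Proof.
move=> d0 c0 /(ler_wpM2l (exprn_ge0 n.-1 (ler0n R d))) h; apply: le_trans h _.
have d0' : 0 < d%:R :> R by rewrite ltr0n.
rewrite ler_pdivlMr //.
have E (x : R) : x ^+ n = x ^+ n.-1 * x by rewrite -exprSr prednK.
have -> : d%:R ^+ n.-1 * (c * (N %/ d)%N%:R ^+ n) * d%:R = c * (d * (N %/ d))%N%:R ^+ n :> R.
  by rewrite natrM exprMn [d%:R ^+ n]E; ring.
apply: ler_wpM2l => //; apply: lerXn2r; rewrite ?nnegrE // ler_nat mulnC.
exact: leq_trunc_div.
Qed.

Lemma invf_subS z : z.+1%:R^-1 - z.+2%:R^-1 = (z.+1%:R * z.+2%:R)^-1 :> R.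
Proof.
have -> : z.+2%:R = z.+1%:R + 1 :> R by rewrite natr1.
by field; rewrite !(nat1r, natr1, pnatr_eq0).
Qed.

Lemma psigma_le_succ z : psig z.+2 <= z.+2%:R / z.+1%:R.
Proof.
by have := @psigma_le z.+2 isT; have -> : z.+2%:R - 1 = z.+1%:R :> R by rewrite -natr1 addrK.
Qed.

(** With [p = z.+2], this and the next bound dominate both corrections in the recurrence by
    [1/((p-1)p)], which telescopes by [invf_subS]. *)
Lemma psigma_sub1_le z : (psig z.+2 - 1) / z.+2%:R <= (z.+1%:R * z.+2%:R)^-1.
Proof.
rewrite invfM ler_wpM2r ?invr_ge0 // lerBlDr; apply: le_trans (psigma_le_succ z) _.
rewrite le_eqVlt; apply/orP; left; apply/eqP.
by rewrite -[z.+2%:R]natr1; field; rewrite !(nat1r, natr1, pnatr_eq0).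
Qed.

Lemma psigma_sqr_le z : psig z.+2 / (z.+2 * z.+2)%:R <= (z.+1%:R * z.+2%:R)^-1.
Proof.
rewrite natrM ler_pdivrMr ?mulr_gt0 ?ltr0n //.
apply: le_trans (psigma_le_succ z) _.
rewrite le_eqVlt; apply/orP; left; apply/eqP.
by field; rewrite nat1r -natrD !pnatr_eq0.
Qed.

(** At level 2 there is no prime and each of the [N] terms is at most [N^(n-1)]. Passing a prime [p]
    costs a factor at most [1 + 1/((p-1)p) <= exp(1/(p-1) - 1/p)], and the exponents telescope. *)
Lemma sieve_sum_le z N : S z.+2 N <= expR (1 - z.+1%:R^-1) * N%:R ^+ n.
Proof.
elim: z N => [|z IH] N.
  rewrite invr1 subrr expR0 mul1r !sieve_sum_recr_nprime // sieve_sum0.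
  rewrite (@le_trans _ _ (\sum_(1 <= m < N.+1) N%:R ^+ n.-1)) //.
    rewrite big_nat_cond [leRHS]big_nat_cond; apply: ler_sum => m /andP[/andP[_ mN] _].
    by apply: lerXn2r; rewrite ?nnegrE // ler_nat.
  by rewrite sumr_const_nat subn1 /= -[leLHS]mulr_natr -exprSr prednK.
set c := expR (1 - z.+1%:R^-1) in IH.
have c0 : 0 <= c by exact: expR_ge0.
have cc : c * (1 + (z.+1%:R * z.+2%:R)^-1) <= expR (1 - z.+2%:R^-1).
  rewrite (_ : 1 - z.+2%:R^-1 = (1 - z.+1%:R^-1) + (z.+1%:R * z.+2%:R)^-1); last first.
    by rewrite -invf_subS; ring.
  by rewrite expRD ler_wpM2l // expR_ge1Dx.
have [pp|npp] := boolP (prime z.+2); last first.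
  rewrite sieve_sum_recr_nprime //; apply: le_trans (IH N) _.
  rewrite ler_wpM2r ?exprn_ge0 //; apply: le_trans cc.
  by rewrite ler_peMr // lerDl invr_ge0 mulr_ge0.
rewrite sieve_sum_recr //.
(* The term at [p * p] is subtracted in the recurrence, so an upper bound may drop it. *)
have h2 : 0 <= psig z.+2 * ((z.+2 * z.+2)%:R ^+ n.-1 * S z.+2 (N %/ (z.+2 * z.+2))).
  by rewrite !mulr_ge0 ?psigma_ge0 ?exprn_ge0 ?sieve_sum_ge0.
have h1 := @scaled_bound c _ z.+2 N isT c0 (IH (N %/ z.+2)%N).
have b0 : 0 <= psig z.+2 - 1 by rewrite subr_ge0 psigma_ge1.
have b1 := psigma_sub1_le z.
apply: le_trans (_ : (c * (1 + (z.+1%:R * z.+2%:R)^-1)) * N%:R ^+ n <= _); last first.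
  by rewrite ler_wpM2r ?exprn_ge0.
rewrite lerBlDr; apply: ler_wpDr => //.
rewrite mulrDr mulr1 mulrDl lerD //.
apply: le_trans (ler_wpM2l b0 h1) _.
set d := z.+2%:R^-1 in b1 *; set b := psig _ - 1 in b1 *.
rewrite [leLHS](_ : _ = c * (b * d) * N%:R ^+ n); last by ring.
by rewrite ler_wpM2r ?exprn_ge0 // ler_wpM2l.
Qed.

Lemma sieve_sum_le_expR1 z N : S z.+2 N <= expR 1 * N%:R ^+ n.
Proof.
apply: le_trans (sieve_sum_le z N) _; rewrite ler_wpM2r ?exprn_ge0 // ler_expR.
by rewrite lerBlDr lerDl invr_ge0.
Qed.

Lemma sieve_sum_step z N :
  `|S z.+3 N - S z.+2 N| <= 2 * expR 1 * (z.+1%:R^-1 - z.+2%:R^-1) * N%:R ^+ n.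
Proof.
have e0 : 0 <= expR 1 :> R := expR_ge0 _.
have N0 : 0 <= N%:R ^+ n :> R by rewrite exprn_ge0.
have t0 : 0 <= (z.+1%:R * z.+2%:R)^-1 :> R by rewrite invr_ge0 mulr_ge0.
rewrite invf_subS; have [pp|npp] := boolP (prime z.+2); last first.
  by rewrite sieve_sum_recr_nprime // subrr normr0 !mulr_ge0.
have E (a b c : R) : a + b - c - a = b - c by ring.
rewrite sieve_sum_recr // E.
have b0 : 0 <= psig z.+2 - 1 by rewrite subr_ge0 psigma_ge1.
(* Both correction terms lie between 0 and the same [D]-bound, which controls their difference. *)
have hb b d (D : R) : 0 <= b -> (0 < d)%N -> b / d%:R <= D ->
    0 <= b * (d%:R ^+ n.-1 * S z.+2 (N %/ d)) <= expR 1 * D * N%:R ^+ n.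
  move=> bb d0 bD; rewrite !mulr_ge0 ?exprn_ge0 ?sieve_sum_ge0 //=.
  apply: le_trans (ler_wpM2l bb (scaled_bound d0 e0 (sieve_sum_le_expR1 z _))) _.
  rewrite [leLHS](_ : _ = expR 1 * (b / d%:R) * N%:R ^+ n); last by ring.
  by rewrite ler_wpM2r // ler_wpM2l.
have /andP[h1 h1'] := hb _ _ _ b0 (isT : (0 < z.+2)%N) (psigma_sub1_le z).
have /andP[h2 h2'] := hb _ _ _ (psigma_ge0 z.+2) (isT : (0 < z.+2 * z.+2)%N) (psigma_sqr_le z).
rewrite ler_norml; move: h1 h1' h2 h2'; set A := _ * _; set B := psig z.+2 * _.
set D := expR 1 * _ * _ => h1 h1' h2 h2'.
rewrite (_ : 2 * _ * _ * _ = 2 * D); last by rewrite /D; ring.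
by apply/andP; split; lra.
Qed.

(** The one-step bounds telescope, leaving an estimate independent of [k]: this is the uniformity
    needed to exchange the limits. *)
Lemma sieve_sum_tail z k N : `|S (z + k).+2 N - S z.+2 N| <= 2 * expR 1 / z.+1%:R * N%:R ^+ n.
Proof.
have e0 : 0 <= expR 1 :> R := expR_ge0 _.
have N0 : 0 <= N%:R ^+ n :> R by rewrite exprn_ge0.
suff h : `|S (z + k).+2 N - S z.+2 N| <=
    2 * expR 1 * (z.+1%:R^-1 - (z + k).+1%:R^-1) * N%:R ^+ n.
  by apply: le_trans h _; rewrite ler_wpM2r // ler_wpM2l ?mulr_ge0 // lerBlDr lerDl invr_ge0.
elim: k => [|k IH]; first by rewrite addn0 !subrr normr0 mulr0 mul0r.
rewrite addnS; apply: le_trans (ler_distD (S (z + k).+2 N) _ _) _.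
apply: le_trans (lerD (sieve_sum_step (z + k) N) IH) _.
rewrite le_eqVlt; apply/orP; left; apply/eqP; ring.
Qed.

End SieveBounds.

(** * Limits in [N] at fixed level, and on the diagonal *)

Section SieveLimits.
Variables (R : realType) (n : nat).
Hypothesis n_gt0 : (0 < n)%N.

Local Notation psig := (psigma R n).
Local Notation S := (sieve_sum R n).

Lemma invn_cvg0 (c : R) : c / N%:R @[N --> \oo] --> (0 : R).
Proof.
have : N.+1%:R^-1 @[N --> \oo] --> (0 : R) := @cvg_harmonic R.
rewrite (cvg_shiftS (fun N => N%:R^-1 : R)) => h.
by rewrite -[0](mulr0 c); apply: cvgM => //; exact: cvg_cst.
Qed.

Lemma floor_ratio_cvg (d : nat) : (0 < d)%N ->
  (N %/ d * d)%N%:R / N%:R @[N --> \oo] --> (1 : R).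
Proof.
move=> d0; apply: (@squeeze_cvgr _ _ _ _ (fun N => 1 - d%:R / N%:R) (fun=> 1)).
- near=> N; have N0 : (0 < N)%N by near: N; exact: nbhs_infty_gt.
  have N0' : 0 < N%:R :> R by rewrite ltr0n.
  rewrite ler_pdivlMr // ler_pdivrMr // mul1r mulrBl mul1r divfK ?gt_eqF //.
  rewrite ler_nat leq_trunc_div andbT lerBlDr -natrD ler_nat.
  by rewrite {1}(divn_eq N d) leq_add2l ltnW // ltn_mod.
- rewrite -[X in _ --> X]subr0; apply: cvgB; [exact: cvg_cst | exact: invn_cvg0].
- exact: cvg_cst.
Unshelve. all: by end_near. Qed.

Lemma divn_cvg_infty d : (0 < d)%N -> (N %/ d)%N @[N --> \oo] --> \oo.
Proof.
move=> d0 A [M _ MA]; exists (M * d)%N => // N /= MN; apply: MA => /=.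
by rewrite leq_divRL.
Qed.

(** With [q = N %/ d], the quotient factors as [u q / q^n], times [(q * d / N)^n], times [1/d]; the
    middle factor tends to 1. *)
Lemma dilate_cvg (u : nat -> R) (l : R) d : (0 < d)%N ->
    u N / N%:R ^+ n @[N --> \oo] --> l ->
  d%:R ^+ n.-1 * u (N %/ d)%N / N%:R ^+ n @[N --> \oo] --> l / d%:R.
Proof.
move=> d0 ul; have d0' : d%:R != 0 :> R by rewrite pnatr_eq0 -lt0n.
have h : (u (N %/ d)%N / (N %/ d)%N%:R ^+ n) * ((N %/ d * d)%N%:R / N%:R) ^+ n / d%:R
     @[N --> \oo] --> l * 1 ^+ n / d%:R.
  apply: cvgM; last exact: cvg_cst.
  apply: cvgM; first exact: (cvg_comp _ _ (divn_cvg_infty d0) ul).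
  exact: (cvg_comp _ _ (floor_ratio_cvg d0) (@exprn_continuous R n 1)).
rewrite expr1n mulr1 in h; apply: cvg_trans h; apply: near_eq_cvg.
near=> N; have Nd : (d <= N)%N by near: N; exact: nbhs_infty_ge.
have q0 : (N %/ d)%N%:R != 0 :> R by rewrite pnatr_eq0 -lt0n divn_gt0.
have N0 : N%:R != 0 :> R by rewrite pnatr_eq0 -lt0n (leq_trans d0).
have E (x : R) : x ^+ n = x ^+ n.-1 * x by rewrite -exprSr prednK.
rewrite expr_div_n natrM exprMn [d%:R ^+ n]E.
by field; rewrite ?expf_neq0 ?d0' ?N0.
Unshelve. all: by end_near. Qed.

(** The difference of powers is a sum of [n] monomials of degree [n-1] in [m] and [m.+1]. *)
Lemma succX_bounds (m : nat) : n%:R * m%:R ^+ n.-1 <= m.+1%:R ^+ n - m%:R ^+ n :> R /\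
  m.+1%:R ^+ n - m%:R ^+ n <= n%:R * m.+1%:R ^+ n.-1 :> R.
Proof.
have mm : m%:R <= m.+1%:R :> R by rewrite ler_nat.
rewrite subrXX (_ : m.+1%:R - m%:R = 1); last by rewrite -natr1; ring.
rewrite mul1r -[n in n%:R]card_ord -sum1_card natr_sum !mulr_suml.
have E (i : 'I_n) : n.-1 = ((n.-1 - i) + i)%N by case: i => i /=; lia.
split; apply: ler_sum => i _; rewrite mul1r [in X in X <= _](E i) [in X in _ <= X](E i) ?addnK !exprD.
  rewrite ler_wpM2r ?exprn_ge0 //; apply: lerXn2r; rewrite ?nnegrE //.
rewrite ler_wpM2l ?exprn_ge0 //; apply: lerXn2r; rewrite ?nnegrE //.
Qed.

Lemma power_sum_bounds (N : nat) :
  (N%:R ^+ n : R) <= n%:R * (\sum_(1 <= m < N.+1) m%:R ^+ n.-1)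
    <= (N%:R ^+ n + n%:R * N%:R ^+ n.-1 : R).
Proof.
elim: N => [|N /andP[IH1 IH2]].
  by rewrite big_geq // mulr0 expr0n eqn0Ngt n_gt0 lexx add0r mulr_ge0 ?exprn_ge0.
have [h1 h2] := succX_bounds N; rewrite big_nat_recr //= mulrDr; apply/andP; split.
  by rewrite -lerBlDr; apply: le_trans IH1; rewrite lerBlDr -lerBlDl.
by rewrite lerD2r; apply: le_trans IH2 _; rewrite -lerBrDl.
Qed.

Lemma power_sum_cvg :
  (\sum_(1 <= m < N.+1) m%:R ^+ n.-1) / N%:R ^+ n @[N --> \oo] --> (n%:R^-1 : R).
Proof.
have nn0 : 0 < n%:R :> R by rewrite ltr0n.
apply: (@squeeze_cvgr _ _ _ _ (fun=> n%:R^-1) (fun N => n%:R^-1 + 1 / N%:R)).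
- near=> N; have N0 : (0 < N)%N by near: N; exact: nbhs_infty_gt.
  have N0' : 0 < N%:R :> R by rewrite ltr0n.
  have Nn0 : 0 < N%:R ^+ n :> R by rewrite exprn_gt0.
  have /andP[h1 h2] := power_sum_bounds N.
  have E : N%:R ^+ n = N%:R ^+ n.-1 * N%:R :> R by rewrite -exprSr prednK.
  rewrite ler_pdivlMr // ler_pdivrMr //; apply/andP; split.
    by rewrite -(ler_pM2l nn0) mulrA mulfV ?gt_eqF // mul1r.
  rewrite -(ler_pM2l nn0); apply: le_trans h2 _; rewrite E le_eqVlt.
  by apply/orP; left; apply/eqP; field; rewrite !gt_eqF.
- exact: cvg_cst.
- rewrite -[X in _ --> X]addr0; apply: cvgD; [exact: cvg_cst | exact: invn_cvg0].
Unshelve. all: by end_near. Qed.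

(** For [s >= 2] these are the partial Euler products of [1/zeta(s)]. *)
Definition euler_partial (s y : nat) : R := \prod_(0 <= p < y | prime p) (1 - p%:R ^- s).

Lemma euler_partial_recr s y :
  euler_partial s y.+1 = euler_partial s y * (if prime y then 1 - y%:R ^- s else 1).
Proof. by rewrite /euler_partial big_mkcond big_nat_recr //= -big_mkcond. Qed.

Lemma sieve_sum_cvg y :
  S y N / N%:R ^+ n @[N --> \oo] --> euler_partial n.+1 y / n%:R.
Proof.
elim: y => [|y IH].
  rewrite /euler_partial big_geq // mul1r; under eq_fun do rewrite sieve_sum0.
  exact: power_sum_cvg.
rewrite euler_partial_recr; case: ifP => [pp|/negbT npp]; last first.
  by rewrite mulr1; under eq_fun do rewrite sieve_sum_recr_nprime //.
set l := _ / _ in IH; have y0 := prime_gt0 pp.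
have y0' : y%:R != 0 :> R by rewrite pnatr_eq0 -lt0n.
have -> : euler_partial n.+1 y * (1 - y%:R ^- n.+1) / n%:R =
    l + (psig y - 1) * (l / y%:R) - psig y * (l / (y * y)%:R).
  (* The new factor [1 + (psig y - 1)/y - psig y/y^2] is regrouped so that [psigmaM] collapses it to
     [1 - y^-(n+1)]. *)
  transitivity (l * (1 - y%:R^-1 + y%:R^-1 * (psig y * (1 - y%:R^-1)))).
    by rewrite psigmaM exprS invfM /l; ring.
  by rewrite natrM invfM; ring.
have yy0 : (0 < y * y)%N by rewrite muln_gt0 y0.
have H : S y N / N%:R ^+ n
      + (psig y - 1) * (y%:R ^+ n.-1 * S y (N %/ y) / N%:R ^+ n)
      - psig y * ((y * y)%:R ^+ n.-1 * S y (N %/ (y * y)) / N%:R ^+ n) @[N --> \oo]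
    --> l + (psig y - 1) * (l / y%:R) - psig y * (l / (y * y)%:R).
  apply: cvgB; first apply: (cvgD IH).
    by apply: cvgM (dilate_cvg y0 IH); exact: cvg_cst.
  by apply: cvgM (dilate_cvg yy0 IH); exact: cvg_cst.
apply: cvg_trans H; apply: near_eq_cvg; near=> N.
by rewrite sieve_sum_recr //=; set c := (N%:R ^+ n)^-1; ring.
Unshelve. all: by end_near. Qed.

(** The diagonal is compared with a fixed level [z.+2]: the tail bound is uniform in [N], the fixed
    level has a known limit, and that limit is close to [r / n]. Each error takes a third of
    [eps]. *)
Lemma sieve_sum_diag_cvg (r : R) : euler_partial n.+1 y @[y --> \oo] --> r ->
  S N.+1 N / N%:R ^+ n @[N --> \oo] --> r / n%:R.
Proof.
move=> Pr; have Prn : euler_partial n.+1 y / n%:R @[y --> \oo] --> r / n%:R.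
  by apply: cvgM => //; exact: cvg_cst.
apply/cvgrPdist_le => eps eps0; have e3 : 0 < eps / 3 by rewrite divr_gt0.
have [z [h1 h2]] : exists z : nat, 2 * expR 1 / z.+1%:R <= eps / 3 /\
    `|r / n%:R - euler_partial n.+1 z.+2 / n%:R| <= eps / 3.
  have /cvgrPdist_le/(_ _ e3) H1 := invn_cvg0 (2 * expR 1).
  have /cvgrPdist_le/(_ _ e3) H2 := Prn.
  have [M _ HM] : \forall y \near \oo, `|0 - 2 * expR 1 / y%:R| <= eps / 3 /\
     `|r / n%:R - euler_partial n.+1 y / n%:R| <= eps / 3.
    by near=> y; split; near: y.
  (* The two conditions are read off at different indices: the tail bound at [M.+1], the Euler
     product at [M.+2]. *)
  exists M; split; last by have [|//] := HM M.+2 _; rewrite /= ltnW.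
  have [+ _] := HM M.+1 (leqnSn M); rewrite sub0r normrN; apply: le_trans; exact: ler_norm.
have /cvgrPdist_le/(_ _ e3) h3 := @sieve_sum_cvg z.+2.
near=> N.
have zN : (z < N)%N by near: N; exact: nbhs_infty_gt.
have N0 : 0 < N%:R ^+ n :> R by rewrite exprn_gt0 // ltr0n (leq_ltn_trans _ zN).
have H3 : `|euler_partial n.+1 z.+2 / n%:R - S z.+2 N / N%:R ^+ n| <= eps / 3 by near: N.
have H4 : `|S z.+2 N / N%:R ^+ n - S N.+1 N / N%:R ^+ n| <= eps / 3.
  rewrite distrC -mulrBl normrM [X in _ * X]ger0_norm ?invr_ge0 ?(ltW N0) // ler_pdivrMr //.
  have -> : N.+1 = (z + (N - z.+1)).+2 by rewrite -[in LHS](subnKC zN).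
  apply: le_trans (sieve_sum_tail R n_gt0 _ _ _) _.
  by rewrite ler_wpM2r // ltW.
rewrite (_ : eps = eps / 3 + eps / 3 + eps / 3); last by field.
apply: le_trans (ler_distD (S z.+2 N / N%:R ^+ n) _ _) _; rewrite lerD //.
by apply: le_trans (ler_distD (euler_partial n.+1 z.+2 / n%:R) _ _) _; rewrite lerD.
Unshelve. all: by end_near. Qed.

End SieveLimits.

(** * The sum of inverse squares and its Euler product *)

Section Basel.
Variable R : realType.
Implicit Types x : R.

Lemma sin_le_id x : 0 < x < pi / 2 -> sin x <= x.
Proof.
move=> /andP[x0 xpi].
have [c _] : exists2 c, c \in `]0, x[ & sin x - sin 0 = cos c * (x - 0).
  apply: MVT => //; exact/continuous_subspaceT/continuous_sin.
by rewrite sin0 !subr0 => ->; rewrite ler_piMl ?cos_le1 // ltW.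
Qed.

Lemma id_le_tan x : 0 < x < pi / 2 -> x <= tan x.
Proof.
move=> /andP[x0 xpi].
have cos_neq0 y : 0 <= y <= x -> cos y != 0.
  move=> /andP[y0 yx]; rewrite gt_eqF // cos_gt0_pihalf // (le_lt_trans yx) // andbT.
  by rewrite (lt_le_trans _ y0) // oppr_lt0 divr_gt0 // pi_gt0.
have [c] : exists2 c, c \in `]0, x[ & tan x - tan 0 = (cos c) ^- 2 * (x - 0).
  apply: MVT => // [y|].
    rewrite in_itv /= => /andP[y0 yx]; apply: is_derive_tan.
    by apply: cos_neq0; rewrite !ltW.
  apply: continuous_in_subspaceT => y; rewrite inE /= in_itv /= => yx.
  exact/continuous_tan/cos_neq0.
rewrite in_itv /= => /andP[c0 cx]; rewrite tan0 !subr0 => ->.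
rewrite ler_peMl ?(ltW x0) // cos2_tan2 ?lerDl ?sqr_ge0 //.
by apply: cos_neq0; rewrite !ltW.
Qed.

(** Invert and square [sin x <= x <= tan x], using [1/tan^2 = 1/sin^2 - 1]. *)
Lemma inv_sqr_bounds x : 0 < x < pi / 2 ->
  (sin x) ^- 2 - 1 <= x ^- 2 <= (sin x) ^- 2.
Proof.
move=> hx; have /andP[x0 xpi] := hx.
have s0 : 0 < sin x := sin_gt0_pihalf hx.
have c0 : 0 < cos x.
  by rewrite cos_gt0_pihalf // xpi andbT (lt_trans _ x0) // oppr_lt0 divr_gt0 // pi_gt0.
have sx := sin_le_id hx; have xt := id_le_tan hx.
apply/andP; split; last first.
  rewrite lef_pV2 ?posrE ?exprn_gt0 //.
  by apply: lerXn2r; rewrite ?nnegrE // ltW.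
have -> : (sin x) ^- 2 - 1 = (tan x) ^- 2.
  rewrite /tan expr_div_n invf_div [cos x ^+ 2]cos2sin2.
  by field; rewrite gt_eqF.
have t0 : 0 < tan x := lt_le_trans x0 xt.
rewrite lef_pV2 ?posrE ?exprn_gt0 //.
by apply: lerXn2r => //; rewrite nnegrE ltW.
Qed.

(** For [j < 2 ^ k] these are the odd multiples of [pi / 2^(k+2)] in the first quadrant; doubling an
    angle of level [k.+1] gives the one of level [k] with the same [j]. *)
Definition basel_angle (k j : nat) : R := (2 * j + 1)%N%:R * pi / 2 ^+ k.+2.

Lemma basel_angle_itv k j : (j < 2 ^ k)%N -> 0 < basel_angle k j < pi / 2.
Proof.
move=> jk; have h2 : 0 < 2 ^+ k.+2 :> R by rewrite exprn_gt0.
rewrite /basel_angle; apply/andP; split.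
  by apply: divr_gt0 => //; apply: mulr_gt0; [rewrite ltr0n addn1 | exact: pi_gt0].
rewrite ltr_pdivrMr // mulrC -[ltRHS]mulrA ltr_pM2l ?pi_gt0 //.
rewrite exprS mulKf // -natrX ltr_nat expnS; lia.
Qed.

(** The angles of level [k.+1] pair up as [t] and [pi/2 - t]; each pair contributes
    [1/sin^2 t + 1/cos^2 t], which is four times the term of level [k] at [2t]. The start is
    [1/sin^2 (pi/4) = 2]. *)
Lemma csc_sqr_sum k :
  \sum_(0 <= j < 2 ^ k) (sin (basel_angle k j)) ^- 2 = 2 * 4 ^+ k.
Proof.
elim: k => [|k IH].
  rewrite expn0 big_nat1 expr0 mulr1 sin2cos2.
  have := cos_mulr2n (basel_angle 0 0).
  have -> : basel_angle 0 0 *+ 2 = pi / 2.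
    by rewrite /basel_angle muln0 add0n mul1r; field.
  rewrite cos_pihalf => h.
  have -> : 1 - cos (basel_angle 0 0) ^+ 2 = 2^-1 by move: h; rewrite mulr2n; lra.
  by rewrite invrK.
rewrite expnS mul2n -addnn (@big_cat_nat _ _ _ (2 ^ k)) //= ?leq_addr //.
(* Reversing the upper half of the range matches each of its angles with its complement in the lower
   half. *)
have -> : \sum_(2 ^ k <= j < 2 ^ k + 2 ^ k) sin (basel_angle k.+1 j) ^- 2 =
    \sum_(0 <= j < 2 ^ k) cos (basel_angle k.+1 j) ^- 2.
  rewrite big_nat_rev /= -{1}[(2 ^ k)%N]add0n big_addn addnK.
  apply: eq_big_nat => j /andP[_ jk].
  congr (_ ^- 2); rewrite -cosBpihalf -[RHS]cosN; congr cos.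
  have -> : (2 ^ k + (2 ^ k + 2 ^ k) - (j + 2 ^ k).+1 = 2 ^ k + 2 ^ k - j.+1)%N by lia.
  have h2 : 2 ^+ k != 0 :> R by rewrite expf_neq0.
  have jk2 : (j < 2 ^ k + 2 ^ k)%N by lia.
  have E a : (2 * a + 1)%N%:R = 2 * a%:R + 1 :> R by rewrite natrD natrM.
  rewrite /basel_angle !E natrB // natrD natrX -natr1 !exprS.
  by field.
rewrite -big_split /=.
have -> : 2 * 4 ^+ k.+1 = 4 * (2 * 4 ^+ k) :> R by rewrite exprS; ring.
rewrite -IH mulr_sumr; apply: eq_big_nat => j /andP[_ jk].
have a2 : basel_angle k j = basel_angle k.+1 j *+ 2.
  rewrite /basel_angle [2 ^+ k.+3]exprS; field; rewrite ?expf_neq0 //.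
have hj := basel_angle_itv jk.
have /andP[h0 hpi] := hj.
set t := basel_angle k.+1 j in a2 *.
have ht : 0 < t < pi / 2.
  move: h0 hpi; rewrite a2 => h0 hpi; apply/andP; split; lra.
have s0 : 0 < sin t := sin_gt0_pihalf ht.
have c0 : 0 < cos t by rewrite cos_gt0_pihalf //; have := pi_gt0 R; lra.
rewrite a2 sin_mulr2n -[_ *+ 2]mulr_natl.
have E := cos2Dsin2 t.
have -> : 4 / (2 * (cos t * sin t)) ^+ 2 = (cos t ^+ 2 + sin t ^+ 2) / (cos t ^+ 2 * sin t ^+ 2).
  by rewrite E; field; rewrite !gt_eqF.
by field; rewrite !gt_eqF.
Qed.

End Basel.

(** * From the odd inverse squares to the product of [1 - p^-2] *)

Section EulerProduct.
Variable R : realType.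

Definition odd_sqr_sum (M : nat) : R := \sum_(0 <= j < M) (2 * j + 1)%N%:R ^- 2.

(** Sum [inv_sqr_bounds] over the [2 ^ k] angles: the upper bound is [2 * 4^k], the lower one
    smaller by [2 ^ k]. *)
Lemma odd_sqr_sum_bounds k :
  pi ^+ 2 / 8 - pi ^+ 2 / 16 * 2^-1 ^+ k <= odd_sqr_sum (2 ^ k) <= pi ^+ 2 / 8.
Proof.
have p0 : 0 < pi :> R := pi_gt0 R.
have h2 : 0 < 2 ^+ k :> R by rewrite exprn_gt0.
have E4 : 4 ^+ k = 2 ^+ k * 2 ^+ k :> R by rewrite -exprMn -natrM.
(* The inverse square of the unit angle [pi / 2^(k+2)]. *)
pose c : R := (16 / pi ^+ 2) * 4 ^+ k.
have c0 : 0 < c by rewrite !mulr_gt0 ?invr_gt0 ?exprn_gt0.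
have angleE : \sum_(0 <= j < 2 ^ k) (basel_angle R k j) ^- 2 = c * odd_sqr_sum (2 ^ k).
  rewrite /odd_sqr_sum mulr_sumr; apply: eq_big_nat => j _.
  have j0 : (2 * j + 1)%N%:R != 0 :> R by rewrite pnatr_eq0 addn1.
  rewrite /basel_angle /c E4 !exprS; move: j0; move: ((2 * j + 1)%N%:R : R) => a a0.
  move: (p0); move: (pi : R) => q q0.
  by field; rewrite a0 !gt_eqF.
have hb (j : nat) : (j < 2 ^ k)%N ->
    (sin (basel_angle R k j)) ^- 2 - 1 <= (basel_angle R k j) ^- 2 <=
    (sin (basel_angle R k j)) ^- 2.
  by move=> jk; exact/inv_sqr_bounds/basel_angle_itv.
have hU : c * odd_sqr_sum (2 ^ k) <= 2 * 4 ^+ k.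
  rewrite -angleE -csc_sqr_sum big_nat_cond [leRHS]big_nat_cond.
  by apply: ler_sum => j /andP[/andP[_ jk] _]; have /andP[] := hb j jk.
have hL : 2 * 4 ^+ k - 2 ^+ k <= c * odd_sqr_sum (2 ^ k).
  rewrite -angleE -csc_sqr_sum.
  have -> : 2 ^+ k = \sum_(0 <= j < 2 ^ k) (1 : R).
    by rewrite sumr_const_nat subn0 -natrX.
  rewrite -sumrB big_nat_cond [leRHS]big_nat_cond.
  by apply: ler_sum => j /andP[/andP[_ jk] _]; have /andP[] := hb j jk.
apply/andP; split; rewrite -(ler_pM2l c0); [apply: le_trans hL | apply: (le_trans hU)];
  rewrite le_eqVlt; apply/orP; left; apply/eqP; rewrite /c E4 ?exprVn;
  move: (p0); move: (pi : R) => q q0; by field; rewrite !gt_eqF.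
Qed.

Lemma odd_sqr_sum_cvg : odd_sqr_sum (2 ^ k) @[k --> \oo] --> pi ^+ 2 / 8.
Proof.
apply: (@squeeze_cvgr _ _ _ _ (fun k => pi ^+ 2 / 8 - pi ^+ 2 / 16 * 2^-1 ^+ k)
  (fun=> pi ^+ 2 / 8)).
- by near=> k; exact: odd_sqr_sum_bounds.
- rewrite -[X in _ --> X]subr0; apply: cvgB; first exact: cvg_cst.
  rewrite -[X in _ --> X](mulr0 (pi ^+ 2 / 16)); apply: cvgM; first exact: cvg_cst.
  by apply: cvg_expr; rewrite ger0_norm ?invr_ge0 // invf_lt1 // ltr1n.
- exact: cvg_cst.
Unshelve. all: by end_near. Qed.

(** The indicator of the [m] without prime factor below [y], as a product so that primes can be
    added one at a time. *)
Definition rough_weight (y m : nat) : R := \prod_(0 <= p < y | prime p) (~~ (p %| m)%N)%:R.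

Definition rough_sum (y N : nat) : R := \sum_(1 <= m < N.+1) m%:R ^- 2 * rough_weight y m.

Lemma rough_weight_recr y m :
  rough_weight y.+1 m = rough_weight y m * (if prime y then (~~ (y %| m)%N)%:R else 1).
Proof. by rewrite /rough_weight big_mkcond big_nat_recr //= -big_mkcond. Qed.

Lemma rough_weight_itv y m : 0 <= rough_weight y m <= 1.
Proof.
elim: y => [|y /andP[h0 h1]]; first by rewrite /rough_weight big_geq // ler01 lexx.
by rewrite rough_weight_recr; case: ifP => _; case: (_ %| _)%N; rewrite ?mulr1 ?mulr0 ?h0 ?ler01 ?lexx.
Qed.

Lemma rough_weight1 y : rough_weight y 1 = 1.
Proof. by apply: big1 => p pp; rewrite dvdn1; case: eqP pp => // ->. Qed.

Lemma rough_weight_eq0 y m : (1 < m < y)%N -> rough_weight y m = 0.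
Proof.
move=> /andP[m1 my]; apply/eqP; rewrite prodf_seq_eq0; apply/hasP; exists (pdiv m).
  rewrite mem_index_iota /=; apply: leq_ltn_trans my.
  by apply: dvdn_leq (pdiv_dvd m); exact: ltnW.
by rewrite pdiv_prime // pdiv_dvd eqxx.
Qed.

Lemma rough_weight_primeM p m : prime p -> rough_weight p (p * m) = rough_weight p m.
Proof.
move=> pp; rewrite /rough_weight big_nat_cond [RHS]big_nat_cond.
apply: eq_bigr => q /andP[/andP[_ qp] pq].
by rewrite Gauss_dvdr // prime_coprime // dvdn_prime2 // ltn_eqF.
Qed.

(** Sieving by [p] removes the multiples [p * m], whose weight at level [p] is that of [m]. *)
Lemma rough_sum_recr p N : prime p ->
  rough_sum p.+1 N = rough_sum p N - p%:R ^- 2 * rough_sum p (N %/ p).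
Proof.
move=> pp; have p0 := prime_gt0 pp.
have -> : p%:R ^- 2 * rough_sum p (N %/ p) =
    \sum_(1 <= m < N.+1 | (p %| m)%N) m%:R ^- 2 * rough_weight p m.
  rewrite big_multiples // mulr_sumr; apply: eq_bigr => m _.
  by rewrite mulrA -invfM -exprMn -natrM rough_weight_primeM //.
rewrite [X in _ - X]big_mkcond -sumrB; apply: eq_bigr => m _.
by rewrite rough_weight_recr pp; case: (p %| m)%N => /=; rewrite ?mulr0 ?subrr ?mulr1 ?subr0.
Qed.

Lemma rough_sum_recr_nprime y N : ~~ prime y -> rough_sum y.+1 N = rough_sum y N.
Proof.
by move=> /negPf py; apply: eq_bigr => m _; rewrite rough_weight_recr py mulr1.
Qed.

Lemma rough_term_ge0 y m : 0 <= m%:R ^- 2 * rough_weight y m.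
Proof.
by have /andP[h _] := rough_weight_itv y m; rewrite mulr_ge0 // invr_ge0 exprn_ge0.
Qed.

Lemma rough_sum_ndecr y : {homo rough_sum y : M N / (M <= N)%N >-> M <= N}.
Proof.
apply/nondecreasing_seqP => N; rewrite /rough_sum [leRHS]big_nat_recr //= lerDl.
exact: rough_term_ge0.
Qed.

Lemma rough_sum3_double M : rough_sum 3 (2 * M) = odd_sqr_sum M.
Proof.
have w3 m : rough_weight 3 m = (odd m)%:R.
  by rewrite /rough_weight big_mkcond !big_nat_recr //= big_geq // !mul1r dvdn2 negbK.
elim: M => [|M IH]; first by rewrite /rough_sum /odd_sqr_sum muln0 !big_geq.
rewrite mulnS /rough_sum add2n; do 2 rewrite big_nat_recr //=.
rewrite -/(rough_sum 3 (2 * M)) IH.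
rewrite /odd_sqr_sum [RHS]big_nat_recr //= !w3 /= mul2n odd_double /= mulr1 mulr0 addr0.
by rewrite addn1.
Qed.

(** Monotone and bounded, the sequence converges; its limit is identified along the subsequence
    [2 * 2 ^ k]. *)
Lemma rough_sum3_cvg : rough_sum 3 N @[N --> \oo] --> pi ^+ 2 / 8.
Proof.
have cv : cvgn (rough_sum 3).
  apply: nondecreasing_is_cvgn; first exact: rough_sum_ndecr.
  exists (pi ^+ 2 / 8) => _ [N _ <-]; have /andP[_] := odd_sqr_sum_bounds N.
  apply: le_trans; rewrite -rough_sum3_double; apply: rough_sum_ndecr.
  by rewrite (leq_trans (ltnW (ltn_expl N (ltnSn 1)))) // leq_pmull.
have sub : (2 * 2 ^ k)%N @[k --> \oo] --> \oo.
  move=> A [M _ MA]; exists M => // k /= Mk; apply: MA => /=.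
  by rewrite (leq_trans Mk) // (leq_trans (ltnW (ltn_expl k (ltnSn 1)))) // leq_pmull.
have h := cvg_comp _ _ sub cv.
suff -> : pi ^+ 2 / 8 = limn (rough_sum 3) by [].
apply: (cvg_unique _ odd_sqr_sum_cvg) => //.
have -> : (fun k => odd_sqr_sum (2 ^ k)) = rough_sum 3 \o (fun k => 2 * 2 ^ k)%N.
  by apply/funext => k /=; rewrite rough_sum3_double.
exact: h.
Qed.

(** The start at level 3 is [pi^2/8 = pi^2/6 * (1 - 1/4)]; each further prime multiplies the limit
    by [1 - p^-2]. *)
Lemma rough_sum_cvg z :
  rough_sum z.+3 N @[N --> \oo] --> pi ^+ 2 / 6 * euler_partial R 2 z.+3.
Proof.
elim: z => [|z IH].
  rewrite (_ : _ * _ = pi ^+ 2 / 8); first exact: rough_sum3_cvg.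
  rewrite /euler_partial big_mkcond !big_nat_recr //= big_geq // !mul1r.
  by field.
rewrite euler_partial_recr; case: ifP => [pp|/negbT npp]; last first.
  by rewrite mulr1; under eq_fun do rewrite rough_sum_recr_nprime //.
under eq_fun do rewrite rough_sum_recr //.
rewrite mulrA mulrBr mulr1 [_ * z.+3%:R ^- 2]mulrC; apply: cvgB => //.
apply: cvgM; first exact: cvg_cst.
exact: (cvg_comp _ _ (@divn_cvg_infty z.+3 isT) IH).
Qed.

Lemma rough_sum_ge1 y N : (0 < N)%N -> 1 <= rough_sum y N.
Proof.
move=> N0; apply: le_trans (_ : rough_sum y 1 <= _); last exact: rough_sum_ndecr.
by rewrite /rough_sum big_nat1 rough_weight1 expr1n invr1 mulr1.
Qed.

(** Between 1 and the level all weights vanish; beyond, [1/m^2 <= 1/(m-1) - 1/m] telescopes. *)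
Lemma rough_sum_le z k :
  rough_sum z.+2 (z.+1 + k) <= 1 + z.+1%:R^-1 - (z.+1 + k)%:R^-1.
Proof.
elim: k => [|k IH].
  rewrite addn0 addrK /rough_sum big_ltn // rough_weight1 expr1n invr1 mulr1.
  rewrite big_nat_cond big1 ?addr0 // => m /andP[/andP[m1 mz] _].
  by rewrite rough_weight_eq0 ?mulr0 // m1.
have h0 : (z.+1 + k).+1%:R ^- 2 * rough_weight z.+2 (z.+1 + k).+1 <= (z.+1 + k).+1%:R ^- 2.
  rewrite ler_piMr ?invr_ge0 ?exprn_ge0 //.
  by have /andP[] := rough_weight_itv z.+2 (z.+1 + k).+1.
have := invf_subS R (z + k); rewrite -addSn => e.
have h : (z.+1 + k).+1%:R ^- 2 <= (z.+1 + k)%:R^-1 - (z.+1 + k).+1%:R^-1 :> R.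
  rewrite e lef_pV2 ?posrE ?exprn_gt0 ?mulr_gt0 // expr2 ler_wpM2r // ler_nat //.
rewrite addnS /rough_sum big_nat_recr //=; apply: le_trans (lerD IH (le_trans h0 h)) _.
by rewrite addrA addrNK.
Qed.

(** As the level grows, only [m = 1] survives: the limit in [N] of the rough sum lies between 1 and
    [1 + 1/z.+2], which pins down the Euler product. *)
Lemma euler_partial2_cvg : euler_partial R 2 y @[y --> \oo] --> 6 / pi ^+ 2.
Proof.
have p0 : 0 < pi :> R := pi_gt0 R.
have bnd z : 1 <= pi ^+ 2 / 6 * euler_partial R 2 z.+3 <= 1 + z.+2%:R^-1.
  apply/andP; split.
    apply: (cvgr_to_ge (@rough_sum_cvg z)); near=> N.
    by apply: rough_sum_ge1; near: N; exact: nbhs_infty_gt.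
  apply: (cvgr_to_le (@rough_sum_cvg z)); near=> N.
  have zN : (z.+2 <= N)%N by near: N; exact: nbhs_infty_ge.
  rewrite -(subnKC zN); apply: le_trans (rough_sum_le _ _) _.
  by rewrite lerBlDr lerDl invr_ge0.
have h : pi ^+ 2 / 6 * euler_partial R 2 z.+3 @[z --> \oo] --> (1 : R).
  apply: (@squeeze_cvgr _ _ _ _ (fun=> 1) (fun z => 1 + z.+2%:R^-1)).
  - by near=> z; exact: bnd.
  - exact: cvg_cst.
  - rewrite -[X in _ --> X]addr0; apply: cvgD; first exact: cvg_cst.
    by rewrite (cvg_shiftS (fun z => z.+1%:R^-1 : R)); exact: cvg_harmonic.
have h' : 6 / pi ^+ 2 * (pi ^+ 2 / 6 * euler_partial R 2 (z + 3)%N) @[z --> \oo]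
    --> 6 / pi ^+ 2 * (1 : R).
  by apply: cvgM; [exact: cvg_cst | under eq_fun do rewrite addn3].
rewrite -(cvg_shiftn 3); rewrite mulr1 in h'; apply: cvg_trans h'.
apply: near_eq_cvg; near=> z => /=; move: (p0); move: (pi : R) => q q0.
by field; rewrite gt_eqF.
Unshelve. all: by end_near. Qed.

End EulerProduct.

(** * The constant and the asymptotic formula *)

Lemma rho_factorE (R : realType) (n p : nat) : (0 < n)%N -> prime p ->
  rho_factor R n p * (1 - p%:R ^- 2) = 1 - p%:R ^- n.+1.
Proof.
case: n => // n _ pp; have p1 : (1 : R) < p%:R by rewrite ltr1n prime_gt1.
rewrite /rho_factor /= !exprS; move: (p%:R : R) p1 => q q1.
have q0 : 0 < q by exact: lt_trans q1.
have qn : q ^+ n != 0 by rewrite expf_neq0 // gt_eqF.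
have q2 : q * (q * q ^+ n) - q ^+ n != 0.
  rewrite mulrA -{2}[q ^+ n]mul1r -mulrBl mulf_neq0 // gt_eqF // subr_gt0.
  by rewrite -[1]mulr1 ltr_pM.
by field; rewrite qn q2 gt_eqF.
Qed.

Lemma euler_partial_gt0 (R : realType) s y : (0 < s)%N -> 0 < euler_partial R s y.
Proof.
move=> s0; apply: prodr_gt0 => p pp.
have p1 : (1 : R) < p%:R by rewrite ltr1n prime_gt1.
by rewrite subr_gt0 invf_lt1 ?exprn_gt0 ?(lt_trans ltr01) // exprn_egt1 // -lt0n.
Qed.

Lemma euler_partial_is_cvg (R : realType) s : (0 < s)%N -> cvgn (euler_partial R s).
Proof.
move=> s0; apply: nonincreasing_is_cvgn.
  apply/nonincreasing_seqP => y; rewrite euler_partial_recr; case: ifP => _; last by rewrite mulr1.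
  by rewrite ler_piMr ?(ltW (euler_partial_gt0 _ _ s0)) // lerBlDr lerDl invr_ge0 exprn_ge0.
by exists 0 => _ [y _ <-]; rewrite ltW // euler_partial_gt0.
Qed.

(** By [rho_factorE] the partial products of [rho] are quotients of Euler products for exponents
    [n.+1] and 2; the limit of the denominator cancels the prefactor [6 / pi^2]. *)
Lemma euler_partial_cvg_rho (R : realType) (n : nat) : (0 < n)%N ->
  euler_partial R n.+1 y @[y --> \oo] --> rho R n.
Proof.
move=> n0; have p0 : 0 < pi :> R := pi_gt0 R.
have c0 : 6 / pi ^+ 2 != 0 :> R by rewrite gt_eqF // divr_gt0 // exprn_gt0.
have E : (fun k => \prod_(0 <= p < k | prime p) rho_factor R n p) =
    (fun k => euler_partial R n.+1 k / euler_partial R 2 k).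
  apply/funext => k; apply: (canRL (mulfK _)); first by rewrite gt_eqF // euler_partial_gt0.
  by rewrite -big_split; apply: eq_bigr => p pp /=; exact: rho_factorE.
have /cvg_ex[/= l hl] := @euler_partial_is_cvg R n.+1 isT.
have h : euler_partial R n.+1 k / euler_partial R 2 k @[k --> \oo] --> l / (6 / pi ^+ 2).
  by apply: cvgM => //; apply: cvgV => //; exact: euler_partial2_cvg.
rewrite /rho E (cvg_lim _ h) //.
by rewrite mulrC divfK.
Qed.

Lemma truncn_cvg_infty (R : realType) : (fun V : R => Num.truncn V) @ +oo --> \oo.
Proof.
move=> A [M _ MA]; exists M%:R; split=> [|V MV]; first exact: num_real.
by apply: MA => /=; rewrite Num.Theory.truncn_ge_nat ltW // (le_lt_trans _ MV).
Qed.

Lemma truncn_ratio_cvg (R : realType) : (fun V : R => (Num.truncn V)%:R / V) @ +oo --> (1 : R).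
Proof.
apply: (@squeeze_cvgr _ (pinfty_nbhs R) _ _ (fun V => 1 - V^-1) (fun=> 1)).
- near=> V; have V0 : 0 < V by near: V; exact: nbhs_pinfty_gt.
  have /andP[h1 h2] := Num.Theory.truncn_itv (ltW V0).
  rewrite ler_pdivlMr // ler_pdivrMr // mul1r h1 andbT mulrBl mul1r mulVf ?gt_eqF //.
  by rewrite lerBlDr natr1 ltW.
- rewrite -[X in _ --> X]subr0; apply: cvgB; first exact: cvg_cst.
  apply/gtr0_cvgV0; last exact: cvg_id.
  by near=> V; near: V; exact: nbhs_pinfty_gt.
- exact: cvg_cst.
Unshelve. all: by end_near. Qed.

Unset Implicit Arguments.

Theorem theorem2p2 (R : realType) (n : nat) (hn : (2 <= n)%N) :
  exists2 e : R -> R, e V @[V --> +oo] --> (0 : R) &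
    forall V : R, 1 <= V ->
      (Nsharp n V)%:R = (rho R n + e V) / n%:R * V ^+ n.
Proof.
have n0 : (0 < n)%N := ltnW hn.
have nn0 : n%:R != 0 :> R by rewrite pnatr_eq0 -lt0n.
(* The error term is obtained by solving the claimed equation for it. *)
exists (fun V => n%:R * ((Nsharp n V)%:R / V ^+ n) - rho R n); last first.
  move=> V V1; have V0 : V ^+ n != 0 by rewrite expf_neq0 // gt_eqF // (lt_le_trans _ V1).
  by rewrite [rho R n + _]addrC subrK [n%:R * _]mulrC mulfK // divfK.
have key : (squarefree_sum n N)%:R / N%:R ^+ n @[N --> \oo] --> rho R n / n%:R.
  under eq_fun do rewrite squarefree_sumE //.
  exact: sieve_sum_diag_cvg (euler_partial_cvg_rho n0).
rewrite -[X in _ --> X](subrr (rho R n)); apply: cvgB; last exact: cvg_cst.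
rewrite -[X in _ --> X](divfK nn0) mulrC; apply: cvgM; first exact: cvg_cst.
(* The count depends only on the integer part of [V], and replacing [V] by it in the denominator
   costs a factor tending to 1. *)
have h : (squarefree_sum n (Num.truncn V))%:R / (Num.truncn V)%:R ^+ n
    * ((Num.truncn V)%:R / V) ^+ n @[V --> +oo] --> rho R n / n%:R * 1 ^+ n.
  apply: cvgM; first exact: (cvg_comp _ _ (@truncn_cvg_infty R) key).
  exact: (cvg_comp _ _ (@truncn_ratio_cvg R) (@exprn_continuous R n 1)).
rewrite expr1n mulr1 in h; apply: cvg_trans h; apply: near_eq_cvg.
near=> V; have V1 : 1 <= V by near: V; exact: nbhs_pinfty_ge.
have V0 : 0 < V := lt_le_trans ltr01 V1.
rewrite Nsharp_squarefree_sum ?(ltW V0) // expr_div_n.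
have t0 : (Num.truncn V)%:R ^+ n != 0 :> R.
  by rewrite expf_neq0 // pnatr_eq0 -lt0n Num.Theory.truncn_ge_nat // ltW.
by rewrite mulrA divfK.
Unshelve. all: by end_near. Qed.
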